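(* Let $K=3388$. The set of $\exists^K\forall^K\exists^K\forall^K$ $\sin$-PA sentences is undecidable; that is, there is no algorithm which, given a $\sin$-PA sentence of the form $$\exists x_1\in\mathbb{Z}^{K}\ \forall x_2\in\mathbb{Z}^{K}\ \exists x_3\in\mathbb{Z}^{K}\ \forall x_4\in\mathbb{Z}^{K}\ \ \Phi(x_1,x_2,x_3,x_4)$$ with $\Phi$ a quantifier-free $\mathcal{L}_{\sin}$-formula, decides whether the sentence is true.
   Context: Let $\mathcal{L}_{\sin}=\{<,+,0,1,\sin,(\lambda_q)_{q\in\mathbb{Q}}\}$, where $\lambda_q$ is a unary function symbol interpreted in $\mathbb{R}$ as $x\mapsto qx$ and all other symbols have their usual interpretation in $\mathbb{R}$ ($\sin:\mathbb{R}\to\mathbb{R}$ is the real sine function). A $\sin$-PA sentence is a statement of the form $Q_1x_1\in\mathbb{Z}^{n_1}\cdots Q_rx_r\in\mathbb{Z}^{n_r}\ \Phi(x_1,\dots,x_r)$, where $Q_1,\dots,Q_r\in\{\forall,\exists\}$ are alternating quantifiers and $\Phi$ is a quantifier-free $\mathcal{L}_{\sin}$-formula (a Boolean combination of equalities and inequalities between terms built from variables and rational numbers by possibly nested applications of $\sin$, addition and rational scalar multiplication). Quantifiers range over integers, while terms are evaluated in $\mathbb{R}$. A class of such sentences is called decidable if there is an algorithm that decides, given a sentence in the class, whether it is true, and undecidable otherwise. *)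

(* Defs.v *)
From HB Require Import structures.
From mathcomp Require Import all_boot all_order all_algebra.
From mathcomp Require Import all_classical all_reals all_analysis.

Set Implicit Arguments.
Unset Strict Implicit.
Unset Printing Implicit Defensive.

Import Order.TTheory GRing.Theory Num.Theory.

Inductive prec_fun : nat -> Type :=
| PZero : prec_fun 0
| PSucc : prec_fun 1
| PProj n (i : 'I_n) : prec_fun n
| PComp m n (f : prec_fun m) (g : 'I_m -> prec_fun n) : prec_fun n
| PRec n (f : prec_fun n) (g : prec_fun n.+2) : prec_fun n.+1
| PMin n (f : prec_fun n.+1) : prec_fun n.

(** [computes f v y]: on input [v] the function [f] is defined, with value [y].
    Primitive recursion is on the first argument:
    h(0, x) = f(x) and h(i+1, x) = g(i, h(i, x), x); the sequence [s] lists
    h(0, x), ..., h(v_0, x).  Minimization is also over the first argument and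
    requires every earlier value to be defined. *)
Fixpoint computes n (f : prec_fun n) : n.-tuple nat -> nat -> Prop :=
  match f in prec_fun n return n.-tuple nat -> nat -> Prop with
  | PZero => fun _ y => y = 0
  | PSucc => fun v y => y = (thead v).+1
  | PProj _ i => fun v y => y = tnth v i
  | PComp m _ f g => fun v y =>
      exists w : m.-tuple nat,
        (forall i, computes (g i) v (tnth w i)) /\ computes f w y
  | PRec _ f g => fun v y =>
      exists s : nat -> nat,
        [/\ computes f [tuple of behead v] (s 0),
            (forall i, i < thead v ->
               computes g [tuple of i :: s i :: behead v] (s i.+1)) &
            y = s (thead v)]
  | PMin _ f => fun v y =>
      computes f [tuple of y :: v] 0 /\
      (forall i, i < y -> exists z, computes f [tuple of i :: v] z.+1)
  end.

Inductive term (n : nat) : Type :=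
| TVar of 'I_n
| TZero
| TOne
| TAdd of term n & term n
| TScale of rat & term n
| TSin of term n.

Arguments TZero {n}.
Arguments TOne {n}.

Inductive qf_formula (n : nat) : Type :=
| FEq of term n & term n
| FLt of term n & term n
| FNot of qf_formula n
| FAnd of qf_formula n & qf_formula n
| FOr of qf_formula n & qf_formula n.

Section Semantics.
Local Open Scope ring_scope.
Variable R : realType.

Fixpoint eval_term n (x : 'rV[int]_n) (t : term n) : R :=
  match t with
  | TVar i => (x 0 i)%:~R
  | TZero => 0
  | TOne => 1
  | TAdd t1 t2 => eval_term x t1 + eval_term x t2
  | TScale q t => ratr q * eval_term x t
  | TSin t => sin (eval_term x t)
  end.

Fixpoint qf_holds n (x : 'rV[int]_n) (phi : qf_formula n) : Prop :=
  match phi with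
  | FEq t1 t2 => eval_term x t1 = eval_term x t2
  | FLt t1 t2 => eval_term x t1 < eval_term x t2
  | FNot phi => ~ qf_holds x phi
  | FAnd phi1 phi2 => qf_holds x phi1 /\ qf_holds x phi2
  | FOr phi1 phi2 => qf_holds x phi1 \/ qf_holds x phi2
  end.

End Semantics.

Inductive quantifier := QExists | QForall.

Definition dual Q := match Q with QExists => QForall | QForall => QExists end.

(** [blocks = [:: n_1; ...; n_r]] and [leading] stand for the prefix
    Q_1 x_1 in Z^{n_1} ... Q_r x_r in Z^{n_r}, where Q_1 is [leading] and the
    quantifiers alternate.  The variables of the matrix are the n_1 + ... + n_r
    coordinates of (x_1, ..., x_r), in this order. *)
Record sentence := Sentence {
  leading : quantifier;
  blocks : seq nat;
  qf_matrix : qf_formula (sumn blocks) }.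

Fixpoint quantify (Q : quantifier) (ns : seq nat) :
    ('rV[int]_(sumn ns) -> Prop) -> Prop :=
  match ns return ('rV[int]_(sumn ns) -> Prop) -> Prop with
  | [::] => fun P => P 0%R
  | n :: ns' => fun P =>
      let rest (x : 'rV[int]_n) :=
        quantify (dual Q) (fun y : 'rV[int]_(sumn ns') => P (row_mx x y)) in
      match Q with
      | QExists => exists x, rest x
      | QForall => forall x, rest x
      end
  end.

Definition holds (R : realType) (s : sentence) : Prop :=
  quantify (leading s) (fun x => qf_holds R x (qf_matrix s)).

(** Cantor's pairing (m + n)(m + n + 1)/2 + n. *)
Definition cpair (m n : nat) : nat := 'C((m + n).+1, 2) + n.

Definition code_int (z : int) : nat :=
  match z with Posz n => n.*2 | Negz n => n.*2.+1 end.

Definition code_rat (q : rat) : nat :=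
  cpair (code_int (numq q)) (code_int (denq q)).

Fixpoint code_term n (t : term n) : nat :=
  match t with
  | TVar i => cpair 0 i
  | TZero => cpair 1 0
  | TOne => cpair 2 0
  | TAdd t1 t2 => cpair 3 (cpair (code_term t1) (code_term t2))
  | TScale q t => cpair 4 (cpair (code_rat q) (code_term t))
  | TSin t => cpair 5 (code_term t)
  end.

Fixpoint code_formula n (phi : qf_formula n) : nat :=
  match phi with
  | FEq t1 t2 => cpair 0 (cpair (code_term t1) (code_term t2))
  | FLt t1 t2 => cpair 1 (cpair (code_term t1) (code_term t2))
  | FNot phi => cpair 2 (code_formula phi)
  | FAnd phi1 phi2 => cpair 3 (cpair (code_formula phi1) (code_formula phi2))
  | FOr phi1 phi2 => cpair 4 (cpair (code_formula phi1) (code_formula phi2))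
  end.

Definition code_seq (ns : seq nat) : nat :=
  foldr (fun n c => (cpair n c).+1) 0 ns.

Definition code_quantifier (Q : quantifier) : nat :=
  match Q with QExists => 0 | QForall => 1 end.

Definition code_sentence (s : sentence) : nat :=
  cpair (code_quantifier (leading s))
        (cpair (code_seq (blocks s)) (code_formula (qf_matrix s))).

(** The algorithm must answer (1 for true, 0 for false) on every sentence of the
    class; nothing is required of it on other inputs. *)
Definition decidable_class (R : realType) (C : sentence -> Prop) : Prop :=
  exists f : prec_fun 1, forall s, C s ->
    exists b : bool,
      computes f [tuple code_sentence s] b /\ (b <-> holds R s).

Definition EAEA_sentence (K : nat) (s : sentence) : Prop :=
  leading s = QExists /\ blocks s = [:: K; K; K; K].

(* Main.v *)
Require Import Defs.
From HB Require Import structures.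
From mathcomp Require Import all_boot all_order all_algebra.
From mathcomp Require Import all_classical all_reals all_analysis.
From mathcomp Require Import ring lra zify.

(* The diagonal argument: if g is the composition of a decision procedure with the map sending
   the code of a formula phi(x) to the code of the sentence phi(c), c the code of phi, and if
   "g(x) = 0" is expressed by a formula of the class, then that formula, applied to its own code,
   is answered wrongly.

   To express g(x) = 0 in a fixed number of variables, the graph of g is generated by finitely
   many rules, each deriving a quadruple of naturals from at most six others subject to linear
   equations; g(x) = 0 iff some finite list of quadruples, each justified by earlier ones,
   contains the right one.  Integers are quantified to code such a list.  Since pi is
   irrational, sin is dense on the naturals.  Let a_0 < a_1 < ... be the records of sin C, i.e.
   the naturals whose sine is below sin C and closer to it than all earlier ones; by moving C,
   the differences h_i = sin C - sin a_i can be made to decrease as fast as desired.  Then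
   reals v near sin b_0 + h_0 cos w_0, near sin b_1 + h_1 cos w_1, ..., nested one in the
   other, carry the values w_i: b_i is the least natural whose sine is within 2 h_i of v, and
   w_i is determined by |v - sin b_i - h_i cos w_i| < h_i cos Y with cos Y small.
   The products are terms up to a factor 2, by 2 sin a cos x = sin (a + x) + sin (a - x).
   Membership in the coded list is an EA condition, and "every member is justified by members
   with smaller a" is therefore AEA; the record a itself serves as the rank. *)

Set Implicit Arguments.
Unset Strict Implicit.
Unset Printing Implicit Defensive.

Import Order.TTheory GRing.Theory Num.Theory numFieldNormedType.Exports.

(** * Rule systems *)

Definition fact := 'I_4 -> nat.

Definition TAG : 'I_4 := Ordinal (isT : 0 < 4).
Definition FA : 'I_4 := Ordinal (isT : 1 < 4).
Definition FB : 'I_4 := Ordinal (isT : 2 < 4).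
Definition FC : 'I_4 := Ordinal (isT : 3 < 4).

Definition mkfact t a b c : fact := fun k => nth 0 [:: t; a; b; c] k.

(* [((i, k), m, (j, l), n)] is the equation "entry k of fact i = m * entry l of fact j + n";
   fact 0 is the conclusion of the rule, facts 1, 2, ... are its premises. *)
Definition equation := ((nat * 'I_4) * nat * (nat * 'I_4) * nat)%type.

Definition eqn_holds (ws : nat -> fact) (e : equation) : bool :=
  let: (l, m, r, n) := e in ws l.1 l.2 == m * ws r.1 r.2 + n.

(** The first component is the number of premises. *)
Definition rule := (nat * seq equation)%type.

Inductive provable (RS : seq rule) : fact -> Prop :=
| Derive r ws : r \in RS -> (forall p, 0 < p <= r.1 -> provable RS (ws p)) ->
    all (eqn_holds ws) r.2 -> provable RS (ws 0).

(** Linear form of a proof tree: a list of facts can be coded by integers, and positions in it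
    replace the inductive structure. *)
Definition derivation (RS : seq rule) (L : seq fact) :=
  forall i, i < size L -> exists r ws,
    [/\ r \in RS, ws 0 = nth (fun=> 0) L i,
        forall p, 0 < p <= r.1 -> exists2 j, j < i & ws p = nth (fun=> 0) L j &
        all (eqn_holds ws) r.2].

Lemma derivation_cat RS L1 L2 :
  derivation RS L1 -> derivation RS L2 -> derivation RS (L1 ++ L2).
Proof.
move=> D1 D2 i; rewrite size_cat => iL; rewrite nth_cat; case: ltnP => i1.
  have [r [ws [h1 h2 h3 h4]]] := D1 i i1; exists r, ws; split => // p /h3 [j ji ->].
  by exists j => //; rewrite nth_cat (ltn_trans ji i1).
have [|r [ws [h1 h2 h3 h4]]] := D2 (i - size L1); first by rewrite ltn_subLR.
exists r, ws; split => // p /h3 [j ji ->].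
exists (size L1 + j); first by rewrite -ltn_subRL.
by rewrite nth_cat ltnNge leq_addr /= addKn.
Qed.

(** The tree is flattened: derivations of the premises are concatenated and the conclusion is
    appended. *)
Lemma provable_derivation RS w : provable RS w ->
  exists2 L, derivation RS L & exists2 i, i < size L & nth (fun=> 0) L i = w.
Proof.
elim=> r ws rRS _ IH eqs.
have [L DL HL] : exists2 L, derivation RS L & forall p, 0 < p <= r.1 ->
    exists2 j, j < size L & ws p = nth (fun=> 0) L j.
  elim: (r.1) IH => [|m IHm] IH; first by exists [::] => // p; case: p.
  have [p /andP [p0 pm]|L1 D1 H1] := IHm; first by apply: IH; rewrite p0 leqW.
  have [|L2 D2 [i iL2 wi]] := IH m.+1; first by rewrite /= leqnn.
  exists (L1 ++ L2); first exact: derivation_cat.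
  move=> p /andP [p0]; rewrite leq_eqVlt => /orP [/eqP ->|pm].
    exists (size L1 + i); first by rewrite size_cat ltn_add2l.
    by rewrite nth_cat ltnNge leq_addr /= addKn.
  have [|j jL ->] := H1 p; first by rewrite p0.
  by exists j; rewrite ?size_cat ?nth_cat ?jL // ltn_addr.
exists (rcons L (ws 0)); last first.
  by exists (size L); rewrite ?size_rcons // nth_rcons ltnn eqxx.
move=> i; rewrite size_rcons ltnS leq_eqVlt => /orP [/eqP ->|iL].
  exists r, ws; split => //; first by rewrite nth_rcons ltnn eqxx.
  by move=> p /HL [j jL ->]; exists j => //; rewrite nth_rcons jL.
have [r' [ws' [h1 h2 h3 h4]]] := DL i iL; exists r', ws'; split => //.
  by rewrite nth_rcons iL.
by move=> p /h3 [j ji ->]; exists j => //; rewrite nth_rcons (ltn_trans ji iL).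
Qed.

(* A pairing function with a linear recursion: <0, b> = 2 b + 1 and <a + 1, b> = 2 <a, b>. *)
Definition ppair (a b : nat) : nat := 2 ^ a * b.*2.+1.

Lemma ppairS a b : ppair a.+1 b = 2 * ppair a b.
Proof. by rewrite /ppair expnS mulnA. Qed.

Lemma ppair0 b : ppair 0 b = 2 * b + 1.
Proof. by rewrite /ppair; lia. Qed.

Lemma ppair_inj a b a' b' : ppair a b = ppair a' b' -> a = a' /\ b = b'.
Proof.
elim: a a' => [|a IH] [|a']; rewrite ?ppairS ?ppair0; try by lia.
move=> E; have [|-> ->] // := IH a' _; lia.
Qed.

(** Functions of one argument, tuples being nested pairs: a tag, an argument, a value and one spare
    entry then suffice for every arity. *)
Inductive ufun :=
| UZero | USucc | UFst | USnd | UNonzero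
| UPair of ufun & ufun
| UComp of ufun & ufun
| URec of ufun & ufun
| UMin of ufun & ufun.

(* [UNonzero] is defined at nonzero arguments only, and in [UMin m u] the function m certifies
   that the values of u at smaller first arguments are nonzero. *)
Fixpoint usem (u : ufun) (x y : nat) : Prop :=
  match u with
  | UZero => y = 0
  | USucc => y = x.+1
  | UFst => exists b, x = ppair y b
  | USnd => exists a, x = ppair a y
  | UNonzero => x != 0 /\ y = 0
  | UPair u v => exists a b, [/\ usem u x a, usem v x b & y = ppair a b]
  | UComp u v => exists2 z, usem v x z & usem u z y
  | URec u v => exists n z s,
      [/\ x = ppair n z, usem u z (s 0),
          forall i, i < n -> usem v (ppair i (ppair (s i) z)) (s i.+1) & y = s n]
  | UMin m u => usem m (ppair y x) 0 /\ usem u (ppair y x) 0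
  end.

Fixpoint ucode (u : ufun) : nat :=
  match u with
  | UZero => ppair 0 0
  | USucc => ppair 1 0
  | UFst => ppair 2 0
  | USnd => ppair 3 0
  | UNonzero => ppair 4 0
  | UPair u v => ppair 5 (ppair (ucode u) (ucode v))
  | UComp u v => ppair 6 (ppair (ucode u) (ucode v))
  | URec u v => ppair 7 (ppair (ucode u) (ucode v))
  | UMin u v => ppair 8 (ppair (ucode u) (ucode v))
  end.

Lemma ucode_inj : injective ucode.
Proof.
elim=> [|||||u IHu v IHv|u IHu v IHv|u IHu v IHv|u IHu v IHv];
  case=> [|||||u' v'|u' v'|u' v'|u' v'] //= /ppair_inj [] //.
all: by move=> _ /ppair_inj [/IHu -> /IHv ->].
Qed.

(* Tag 0: entry c is the pair of entries a and b.  Tag 1: the goal.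
   Tag [utag u]: u maps entry a to entry b. *)
Definition utag u := (ucode u).+2.
Arguments utag : simpl never.

(** The multiplier 0 makes the right-hand entry a dummy. *)
Definition eqc (i : nat) (k : 'I_4) (n : nat) : equation := ((i, k), 0, (0, TAG), n).
Definition eqs (i : nat) (k : 'I_4) (m j : nat) (l : 'I_4) (n : nat) : equation :=
  ((i, k), m, (j, l), n).
Definition eqv i k j l := eqs i k 1 j l 0.

Definition pair_rules : seq rule :=
  [:: (0, [:: eqc 0 TAG 0; eqc 0 FA 0; eqs 0 FC 2 0 FB 1]);
      (1, [:: eqc 0 TAG 0; eqc 1 TAG 0; eqs 0 FA 1 1 FA 1; eqv 0 FB 1 FB; eqs 0 FC 2 1 FC 0])].

(** Premises with tag 0 supply the pairings. The rule for [UNonzero] keeps the predecessor of the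
    argument in the spare entry. In the recursion step, premises 1 and 2 relate (n + 1, z) to (n,
    z), 3 is the previous value, 4 and 5 build the argument of the step function, and 6 is its
    value. *)
Definition node_rules (u : ufun) : seq rule :=
  match u with
  | UZero => [:: (0, [:: eqc 0 TAG (utag u); eqc 0 FB 0])]
  | USucc => [:: (0, [:: eqc 0 TAG (utag u); eqs 0 FB 1 0 FA 1])]
  | UFst => [:: (1, [:: eqc 0 TAG (utag u); eqc 1 TAG 0; eqv 0 FA 1 FC; eqv 0 FB 1 FA])]
  | USnd => [:: (1, [:: eqc 0 TAG (utag u); eqc 1 TAG 0; eqv 0 FA 1 FC; eqv 0 FB 1 FB])]
  | UNonzero => [:: (0, [:: eqc 0 TAG (utag u); eqs 0 FA 1 0 FC 1; eqc 0 FB 0])]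
  | UPair u1 u2 =>
      [:: (3, [:: eqc 0 TAG (utag u); eqc 1 TAG (utag u1); eqc 2 TAG (utag u2); eqc 3 TAG 0;
                  eqv 1 FA 0 FA; eqv 2 FA 0 FA; eqv 3 FA 1 FB; eqv 3 FB 2 FB; eqv 0 FB 3 FC])]
  | UComp u1 u2 =>
      [:: (2, [:: eqc 0 TAG (utag u); eqc 1 TAG (utag u2); eqc 2 TAG (utag u1);
                  eqv 1 FA 0 FA; eqv 2 FA 1 FB; eqv 0 FB 2 FB])]
  | URec u1 u2 =>
      [:: (2, [:: eqc 0 TAG (utag u); eqc 1 TAG 0; eqc 2 TAG (utag u1);
                  eqc 1 FA 0; eqv 0 FA 1 FC; eqv 2 FA 1 FB; eqv 0 FB 2 FB]);
          (6, [:: eqc 0 TAG (utag u); eqc 1 TAG 0; eqc 2 TAG 0; eqc 3 TAG (utag u);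
                  eqc 4 TAG 0; eqc 5 TAG 0; eqc 6 TAG (utag u2);
                  eqv 0 FA 1 FC; eqs 1 FA 1 2 FA 1; eqv 2 FB 1 FB; eqv 3 FA 2 FC;
                  eqv 4 FA 3 FB; eqv 4 FB 1 FB; eqv 5 FA 2 FA; eqv 5 FB 4 FC;
                  eqv 6 FA 5 FC; eqv 0 FB 6 FB])]
  | UMin u1 u2 =>
      [:: (3, [:: eqc 0 TAG (utag u); eqc 1 TAG 0; eqc 2 TAG (utag u1); eqc 3 TAG (utag u2);
                  eqv 1 FA 0 FB; eqv 1 FB 0 FA; eqv 2 FA 1 FC; eqc 2 FB 0;
                  eqv 3 FA 1 FC; eqc 3 FB 0])]
  end.

Fixpoint urules (u : ufun) : seq rule :=
  node_rules u ++
  match u with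
  | UPair u v | UComp u v | URec u v | UMin u v => urules u ++ urules v
  | _ => [::]
  end.

(** The argument x enters as the pair (x, 0), the code of the one-element tuple. *)
Definition goal_rule (u : ufun) : rule :=
  (2, [:: eqc 0 TAG 1; eqc 1 TAG 0; eqc 2 TAG (utag u); eqv 1 FA 0 FA; eqc 1 FB 0;
          eqv 2 FA 1 FC; eqc 2 FB 0]).

Definition system (u : ufun) : seq rule := goal_rule u :: pair_rules ++ urules u.

(** * Soundness of the rule systems *)

(** The intended meaning of a fact, by its tag; the spare entry of a function fact is unconstrained,
    and a fact with any other tag is vacuously true. *)
Definition fact_true (g : ufun) (w : fact) : Prop :=
  [/\ w TAG = 0 -> w FC = ppair (w FA) (w FB),
      w TAG = 1 -> usem g (ppair (w FA) 0) 0 &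
      forall u, w TAG = utag u -> usem u (w FA) (w FB)].

Definition sound_rule g (r : rule) := forall ws : nat -> fact,
  (forall p, 0 < p <= r.1 -> fact_true g (ws p)) -> all (eqn_holds ws) r.2 ->
  fact_true g (ws 0).

Lemma utag_inj : injective utag.
Proof. by move=> u v [] /ucode_inj. Qed.

Lemma fact_true_ufun g w u :
  w TAG = utag u -> usem u (w FA) (w FB) -> fact_true g w.
Proof. by move=> wu uw; split; rewrite ?wu // => v /utag_inj <-. Qed.

Lemma fact_true_pair g w :
  w TAG = 0 -> w FC = ppair (w FA) (w FB) -> fact_true g w.
Proof. by move=> w0 wp; split; rewrite ?w0. Qed.

Lemma eqn_holdsP ws i k m j l n :
  eqn_holds ws (eqs i k m j l n) -> ws i k = m * ws j l + n.
Proof. by move/eqP. Qed.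

Lemma eqn_holdsc ws i k n : eqn_holds ws (eqc i k n) -> ws i k = n.
Proof. by move/eqP. Qed.

Lemma eqn_holdsv ws i k j l : eqn_holds ws (eqv i k j l) -> ws i k = ws j l.
Proof. by move/eqP; rewrite mul1n addn0. Qed.

Lemma usem_rec0 u v z y : usem u z y -> usem (URec u v) (ppair 0 z) y.
Proof. by move=> uy; exists 0, z, (fun=> y). Qed.

Lemma usem_recS u v n z y y' :
  usem (URec u v) (ppair n z) y -> usem v (ppair n (ppair y z)) y' ->
  usem (URec u v) (ppair n.+1 z) y'.
Proof.
move=> [n' [z' [s [/ppair_inj [<- <-] s0 sS ->]]]] vy'.
exists n.+1, z, (fun i => if i < n.+1 then s i else y'); split => //.
- move=> i; rewrite ltnS => lin; rewrite lin !ltnS.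
  move: lin; rewrite leq_eqVlt => /orP [/eqP ->|lin]; first by rewrite ltnn.
  by rewrite lin; exact: sS.
- by rewrite ltnn.
Qed.

(** Curried form of [all], by which [split_eqns] turns the equations of a concrete rule into
    successive premises of the goal. *)
Lemma all_cons_imp (T : Type) (p : pred T) x s (G : Prop) :
  (p x -> all p s -> G) -> all p (x :: s) -> G.
Proof. by move=> H /= /andP []. Qed.

Lemma all_nil_imp (T : Type) (p : pred T) (G : Prop) : G -> all p [::] -> G.
Proof. by []. Qed.

Ltac split_eqns := rewrite [_.2]/=; curry
with curry := first
  [ refine (all_nil_imp _)
  | refine (all_cons_imp _); let h := fresh in intro h; curry; revert h ].

Lemma node_rules_sound g u r : r \in node_rules u -> sound_rule g r.
Proof.
case: u => [|||||u v|u v|u v|u v]; rewrite !inE => //.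
- move=> /eqP -> ws _; split_eqns => /eqn_holdsc t /eqn_holdsc h.
  by apply: (fact_true_ufun _ t); rewrite /= h.
- move=> /eqP -> ws _; split_eqns => /eqn_holdsc t /eqn_holdsP h.
  by apply: (fact_true_ufun _ t); rewrite /= h mul1n addn1.
- move=> /eqP -> ws H; split_eqns => /eqn_holdsc t /eqn_holdsc t1 /eqn_holdsv h1 /eqn_holdsv h2.
  have [/(_ t1) p _ _] := H 1 isT.
  by apply: (fact_true_ufun _ t); exists (ws 1 FB); rewrite h1 h2.
- move=> /eqP -> ws H; split_eqns => /eqn_holdsc t /eqn_holdsc t1 /eqn_holdsv h1 /eqn_holdsv h2.
  have [/(_ t1) p _ _] := H 1 isT.
  by apply: (fact_true_ufun _ t); exists (ws 1 FA); rewrite h1 h2.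
- move=> /eqP -> ws H; split_eqns => /eqn_holdsc t /eqn_holdsP h1 /eqn_holdsc h2.
  by apply: (fact_true_ufun _ t); rewrite /= h1 h2 addn1.
- move=> /eqP -> ws H; split_eqns.
  move=> /eqn_holdsc t /eqn_holdsc t1 /eqn_holdsc t2 /eqn_holdsc t3.
  move=> /eqn_holdsv h1 /eqn_holdsv h2 /eqn_holdsv h3 /eqn_holdsv h4 /eqn_holdsv h5.
  have [_ _ /(_ _ t1) p1] := H 1 isT; have [_ _ /(_ _ t2) p2] := H 2 isT.
  have [/(_ t3) p3 _ _] := H 3 isT.
  apply: (fact_true_ufun _ t); exists (ws 1 FB), (ws 2 FB).
  by split; [rewrite -h1 | rewrite -h2 | rewrite h5 p3 h3 h4].
- move=> /eqP -> ws H; split_eqns.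
  move=> /eqn_holdsc t /eqn_holdsc t1 /eqn_holdsc t2.
  move=> /eqn_holdsv h1 /eqn_holdsv h2 /eqn_holdsv h3.
  have [_ _ /(_ _ t1) p1] := H 1 isT; have [_ _ /(_ _ t2) p2] := H 2 isT.
  by apply: (fact_true_ufun _ t); exists (ws 1 FB); [rewrite -h1 | rewrite h3 -h2].
- case/orP => /eqP -> ws H; split_eqns.
    move=> /eqn_holdsc t /eqn_holdsc t1 /eqn_holdsc t2 /eqn_holdsc h1.
    move=> /eqn_holdsv h2 /eqn_holdsv h3 /eqn_holdsv h4.
    have [/(_ t1) p1 _ _] := H 1 isT; have [_ _ /(_ _ t2) p2] := H 2 isT.
    apply: (fact_true_ufun _ t); rewrite h2 p1 h1 h4.
    by apply: usem_rec0; rewrite -h3.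
  move=> /eqn_holdsc t /eqn_holdsc t1 /eqn_holdsc t2 /eqn_holdsc t3.
  move=> /eqn_holdsc t4 /eqn_holdsc t5 /eqn_holdsc t6.
  move=> /eqn_holdsv h1 /eqn_holdsP h2 /eqn_holdsv h3 /eqn_holdsv h4 /eqn_holdsv h5 /eqn_holdsv h6.
  move=> /eqn_holdsv h7 /eqn_holdsv h8 /eqn_holdsv h9 /eqn_holdsv h10.
  have [/(_ t1) p1 _ _] := H 1 isT; have [/(_ t2) p2 _ _] := H 2 isT.
  have [_ _ /(_ _ t3) p3] := H 3 isT; have [/(_ t4) p4 _ _] := H 4 isT.
  have [/(_ t5) p5 _ _] := H 5 isT; have [_ _ /(_ _ t6) p6] := H 6 isT.
  apply: (fact_true_ufun _ t); rewrite h1 p1 h2 mul1n addn1 h10.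
  apply: (@usem_recS _ _ _ _ (ws 3 FB)); first by rewrite -h3 -p2 -h4.
  by rewrite -h6 -h5 -p4 -h8 -h7 -p5 -h9.
- move=> /eqP -> ws H; split_eqns.
  move=> /eqn_holdsc t /eqn_holdsc t1 /eqn_holdsc t2 /eqn_holdsc t3.
  move=> /eqn_holdsv h1 /eqn_holdsv h2 /eqn_holdsv h3 /eqn_holdsc h4 /eqn_holdsv h5 /eqn_holdsc h6.
  have [/(_ t1) p1 _ _] := H 1 isT; have [_ _ /(_ _ t2) p2] := H 2 isT.
  have [_ _ /(_ _ t3) p3] := H 3 isT.
  apply: (fact_true_ufun _ t); split; rewrite -h1 -h2 -p1.
    by rewrite -h3 -{2}h4.
  by rewrite -h5 -{2}h6.
Qed.

Lemma system_sound g w : provable (system g) w -> fact_true g w.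
Proof.
have U u r : r \in urules u -> sound_rule g r.
  elim: u => [|||||u IHu v IHv|u IHu v IHv|u IHu v IHv|u IHu v IHv];
    rewrite /urules -/urules mem_cat => /orP [] //; try exact: node_rules_sound.
  1-4: by rewrite mem_cat => /orP [].
elim=> r ws; rewrite /system inE mem_cat => /orP [/eqP ->|/orP []]; last first.
- by move=> /U S _ IH; apply: S.
- rewrite !inE => /orP [] /eqP -> _ H; split_eqns.
    move=> /eqn_holdsc t /eqn_holdsc h1 /eqn_holdsP h2.
    by apply: fact_true_pair => //; rewrite h2 h1 ppair0.
  move=> /eqn_holdsc t /eqn_holdsc t1 /eqn_holdsP h1 /eqn_holdsv h2 /eqn_holdsP h3.
  have [/(_ t1) p1 _ _] := H 1 isT.
  by apply: fact_true_pair => //; rewrite h3 h1 h2 p1 mul1n addn1 addn0 ppairS.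
- move=> _ H; split_eqns.
  move=> /eqn_holdsc t /eqn_holdsc t1 /eqn_holdsc t2 /eqn_holdsv h1 /eqn_holdsc h2.
  move=> /eqn_holdsv h3 /eqn_holdsc h4.
  have [/(_ t1) p1 _ _] := H 1 isT; have [_ _ /(_ _ t2) p2] := H 2 isT.
  split; rewrite t // => _.
  by rewrite -h1 -{2}h2 -p1 -h3 -{2}h4.
Qed.

(** * Completeness of the rule systems *)

Lemma derive_seq RS r w l : r \in RS -> r.1 = size l ->
  (forall i, i < size l -> provable RS (nth w l i)) ->
  all (eqn_holds (fun p => nth w (w :: l) p)) r.2 -> provable RS w.
Proof.
move=> rRS rl H eqs; apply: (Derive (ws := fun p => nth w (w :: l) p) rRS) => //.
by case=> // p; rewrite rl; exact: H.
Qed.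

Lemma derive_node RS u i w l : {subset urules u <= RS} ->
  let r := nth (0, [::]) (node_rules u) i in
  i < size (node_rules u) -> r.1 = size l ->
  (forall i, i < size l -> provable RS (nth w l i)) ->
  all (eqn_holds (fun p => nth w (w :: l) p)) r.2 -> provable RS w.
Proof.
move=> uRS r iu; apply: derive_seq; apply: uRS.
by case: u @r iu => *; rewrite mem_cat mem_nth.
Qed.

Ltac check_eqns := rewrite /= /eqn_holds /mkfact /= ?mul0n ?mul1n ?addn0 ?add0n ?addn1 ?eqxx.

Ltac premises H := case=> [|[|[|[|[|[|]]]]]] //= _; first [assumption | exact: H].

Lemma provable_pair RS a b : {subset pair_rules <= RS} ->
  provable RS (mkfact 0 a b (ppair a b)).
Proof.
move=> sub; elim: a => [|a IH].
  apply: (@derive_seq _ (nth (0, [::]) pair_rules 0) _ [::]) => //.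
    by apply/sub/mem_nth.
  by check_eqns; rewrite ppair0 addn1 eqxx.
apply: (@derive_seq _ (nth (0, [::]) pair_rules 1) _ [:: mkfact 0 a b (ppair a b)]) => //.
- by apply/sub/mem_nth.
- by case.
- by check_eqns; rewrite ppairS eqxx.
Qed.

(** The last entry is existential because [UNonzero] forces it to be the predecessor of the
    argument; elsewhere 0 is taken. *)
Lemma provable_ufun RS u x y : {subset pair_rules <= RS} -> {subset urules u <= RS} ->
  usem u x y -> exists c, provable RS (mkfact (utag u) x y c).
Proof.
move=> subp; have pp a b := provable_pair a b subp.
have split u1 u2 (s : seq rule) : {subset s ++ urules u1 ++ urules u2 <= RS} ->
    {subset urules u1 <= RS} /\ {subset urules u2 <= RS}.
  by move=> h; split=> r r0; apply: h; rewrite !mem_cat r0 !orbT.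
elim: u x y => [|||||u IHu v IHv|u IHu v IHv|u IHu v IHv|u IHu v IHv] x y sub /=.
- move=> ->; exists 0; apply: (@derive_node _ UZero 0 _ [::]) => //; by check_eqns.
- move=> ->; exists 0; apply: (@derive_node _ USucc 0 _ [::]) => //; by check_eqns.
- move=> [b ->]; exists 0.
  apply: (@derive_node _ UFst 0 _ [:: mkfact 0 y b (ppair y b)]) => //;
    try (by check_eqns); premises pp.
- move=> [a ->]; exists 0.
  apply: (@derive_node _ USnd 0 _ [:: mkfact 0 a y (ppair a y)]) => //;
    try (by check_eqns); premises pp.
- move=> [x0 ->]; exists x.-1; apply: (@derive_node _ UNonzero 0 _ [::]) => //.
  by check_eqns; rewrite prednK ?lt0n // eqxx.
- have [/IHu {}IHu /IHv {}IHv] := split _ _ _ sub.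
  move=> [a [b [/IHu [c ca] /IHv [d db] ->]]]; exists 0.
  apply: (@derive_node _ (UPair u v) 0 _ [:: mkfact (utag u) x a c; mkfact (utag v) x b d;
    mkfact 0 a b (ppair a b)]) => //;
    try (by check_eqns); premises pp.
- have [/IHu {}IHu /IHv {}IHv] := split _ _ _ sub.
  move=> [z /IHv [c cz] /IHu [d dy]]; exists 0.
  apply: (@derive_node _ (UComp u v) 0 _ [:: mkfact (utag v) x z c;
    mkfact (utag u) z y d]) => //;
    try (by check_eqns); premises pp.
- have [/IHu {}IHu /IHv {}IHv] := split _ _ _ sub.
  move=> [n [z [s [-> /IHu [c c0] sS ->]]]].
  have {}sS i : i < n -> exists c,
      provable RS (mkfact (utag v) (ppair i (ppair (s i) z)) (s i.+1) c).
    by move=> /sS /IHv.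
  elim: n sS => [|n IHn] sS.
    exists 0; apply: (@derive_node _ (URec u v) 0 _
      [:: mkfact 0 0 z (ppair 0 z); mkfact (utag u) z (s 0) c]) => //;
    try (by check_eqns); premises pp.
  have [|d dn] := IHn; first by move=> i ni; apply: sS; exact: ltnW.
  have [e en] := sS n (leqnn _); exists 0.
  apply: (@derive_node _ (URec u v) 1 _
      [:: mkfact 0 n.+1 z (ppair n.+1 z); mkfact 0 n z (ppair n z);
       mkfact (utag (URec u v)) (ppair n z) (s n) d;
       mkfact 0 (s n) z (ppair (s n) z);
       mkfact 0 n (ppair (s n) z) (ppair n (ppair (s n) z));
       mkfact (utag v) (ppair n (ppair (s n) z)) (s n.+1) e]) => //;
    try (by check_eqns); premises pp.
- have [/IHu {}IHu /IHv {}IHv] := split _ _ _ sub.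
  move=> [/IHu [c c0] /IHv [d d0]]; exists 0.
  apply: (@derive_node _ (UMin u v) 0 _ [:: mkfact 0 y x (ppair y x);
    mkfact (utag u) (ppair y x) 0 c; mkfact (utag v) (ppair y x) 0 d]) => //;
    try (by check_eqns); premises pp.
Qed.

Lemma system_complete g x : usem g (ppair x 0) 0 -> provable (system g) (mkfact 1 x 0 0).
Proof.
have sp : {subset pair_rules <= system g}.
  by move=> r h; rewrite /system inE mem_cat h orbT.
have su : {subset urules g <= system g}.
  by move=> r h; rewrite /system inE mem_cat h !orbT.
move=> /(provable_ufun sp su) [c gc].
apply: (@derive_seq _ (goal_rule g) _
  [:: mkfact 0 x 0 (ppair x 0); mkfact (utag g) (ppair x 0) 0 c]) => //.
- exact: mem_head.
- premises (provable_pair x 0 sp).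
- by check_eqns.
Qed.

Lemma systemP g x : provable (system g) (mkfact 1 x 0 0) <-> usem g (ppair x 0) 0.
Proof.
split; last exact: system_complete.
by move=> /system_sound [_ /= H _]; exact: H.
Qed.

(** The recursion step has the most premises, six. The facts 0 to 6 of a rule will fill seven slots
    of nine coordinates, whence blocks of at least 63 variables. *)
Definition small_rule (r : rule) : bool :=
  (r.1 <= 6) && all (fun e : equation => (e.1.1.1.1 <= 6) && (e.1.2.1 <= 6)) r.2.

Lemma system_small g r : r \in system g -> small_rule r.
Proof.
have N u : r \in node_rules u -> small_rule r.
  case: u => [|||||u v|u v|u v|u v]; rewrite !inE ?orbF; try by move=> /eqP ->.
  by case/orP => /eqP ->.
have U u : r \in urules u -> small_rule r.
  elim: u => [|||||u IHu v IHv|u IHu v IHv|u IHu v IHv|u IHu v IHv];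
    rewrite /urules -/urules mem_cat => /orP [] //; try exact: N.
  1-4: by rewrite mem_cat => /orP [].
rewrite /system inE mem_cat => /orP [/eqP ->|/orP [|/U]] //.
by rewrite !inE => /orP [] /eqP ->.
Qed.

(** * Partial recursive functions as rule systems *)

Definition tcode (v : seq nat) : nat := foldr ppair 0 v.

Fixpoint uproj (i : nat) : ufun :=
  if i is i'.+1 then UComp (uproj i') USnd else UFst.

Definition upairs (l : seq ufun) : ufun := foldr UPair UZero l.

(** A recursion with all values 0 whose step at i is defined only if u is defined and nonzero at (i,
    x). The step receives (i, (previous value, x)) and drops the previous value. *)
Definition nonzero_below (u : ufun) : ufun :=
  URec UZero (UComp UNonzero (UComp u (UPair UFst (UComp USnd USnd)))).

Fixpoint ufun_of n (f : prec_fun n) : ufun :=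
  match f with
  | PZero => UZero
  | PSucc => UComp USucc UFst
  | PProj _ i => uproj i
  | PComp m _ f g => UComp (ufun_of f) (upairs [seq ufun_of (g i) | i <- enum 'I_m])
  | PRec _ f g => URec (ufun_of f) (ufun_of g)
  | PMin _ f => UMin (nonzero_below (ufun_of f)) (ufun_of f)
  end.

Lemma usem_uproj i v y : i < size v -> usem (uproj i) (tcode v) y <-> y = nth 0 v i.
Proof.
elim: i v => [|i IH] [|a v] //= iv.
  by split=> [[b /ppair_inj [->]]|->] //; exists (tcode v).
rewrite -IH //; split=> [[z [b /ppair_inj [_ ->]]]|] //.
by exists (tcode v) => //; exists a.
Qed.

Lemma usem_upairs l x y : usem (upairs l) x y <->
  exists w, [/\ y = tcode w, size w = size l &
                forall i, i < size l -> usem (nth UZero l i) x (nth 0 w i)].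
Proof.
elim: l y => [|u l IH] y /=.
  by split=> [->|[w [-> /size0nil ->]]] //; exists [::].
split=> [[a [b [ua /IH [w [-> sw wl]] ->]]]|[[|a w] [-> //= [sw] wl]]].
  exists (a :: w); split => //=; first by rewrite sw.
  by case=> // i; exact: wl.
exists a, (tcode w); split => //; first exact: (wl 0).
by apply/IH; exists w; split => // i il; exact: (wl i.+1).
Qed.

Lemma usem_nonzero_below u x y : usem (nonzero_below u) (ppair y x) 0 <->
  forall i, i < y -> exists z, usem u (ppair i x) z.+1.
Proof.
split=> [[n [z [s [/ppair_inj [<- <-] s0 sS sy]]]] i iy|H].
  have [t [_ [a [b [[c E1] [d [e E2] [e' E3]] ->]] ut] [t0 _]]] := sS i iy.
  have [ai _] := ppair_inj (esym E1); have [_ Ed] := ppair_inj (esym E2).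
  move: E3; rewrite Ed => /ppair_inj [_ xb]; subst a b.
  by exists t.-1; rewrite prednK ?lt0n.
exists y, x, (fun=> 0); split => // i /H [z uz].
exists z.+1 => //; exists (ppair i x) => //.
exists i, x; split => //; first by exists (ppair 0 x).
by exists (ppair 0 x); [exists i | exists 0].
Qed.

Lemma tcodeE n (v : n.+1.-tuple nat) :
  tcode v = ppair (thead v) (tcode (behead v)).
Proof. by case/tupleP: v => a v; rewrite theadE. Qed.

Lemma ufun_ofP n (f : prec_fun n) (v : n.-tuple nat) y :
  usem (ufun_of f) (tcode v) y <-> computes f v y.
Proof.
elim: f v y => {n} [||n i|m n f IHf g IHg|n f IHf g IHg|n f IHf] v y /=.
- by [].
- rewrite tcodeE; split=> [[z [b /ppair_inj [-> _]] ->]|->] //.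
  by exists (thead v) => //; exists (tcode (behead v)).
- by rewrite usem_uproj ?size_tuple // (tnth_nth 0).
- split=> [[z /usem_upairs [w [-> sw wg]] fw]|[w [wg fw]]].
    rewrite size_map size_enum_ord in sw wg.
    exists (tcast sw (in_tuple w)); split; last first.
      by apply/IHf; rewrite val_tcast.
    move=> i; apply/IHg; rewrite (tnth_nth 0) val_tcast /=.
    have := wg i (ltn_ord i); rewrite (nth_map i) ?size_enum_ord //.
    by rewrite nth_ord_enum.
  exists (tcode w); last by apply/IHf.
  apply/usem_upairs; exists w; rewrite size_map size_enum_ord size_tuple; split => // i im.
  rewrite (nth_map (Ordinal im)) ?size_enum_ord // (nth_ord_enum _ (Ordinal im)).
  by have /IHg := wg (Ordinal im); rewrite (tnth_nth 0).
- rewrite tcodeE; split.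
    move=> [k [z [s [/ppair_inj [<- <-] s0 sS ->]]]]; exists s; split => //.
      by apply/IHf.
    by move=> i /sS h; apply/IHg.
  move=> [s [/IHf s0 sS ->]]; exists (thead v), (tcode (behead v)), s; split => //.
  by move=> i /sS /IHg.
- split=> [[/usem_nonzero_below H /(IHf [tuple of y :: v])]|[/IHf f0 H]].
    move=> f0; split => // i /H [z fz]; exists z; by apply/IHf.
  split => //; apply/usem_nonzero_below => i /H [z /IHf fz].
  by exists z.
Qed.

(** The system depends on [g] alone; the input enters only through the goal. *)
Lemma computes_system (g : prec_fun 1) c :
  computes g [tuple c] 0 <-> provable (system (ufun_of g)) (mkfact 1 c 0 0).
Proof. by rewrite systemP -ufun_ofP. Qed.

(** Needed at the end of the diagonal argument, where the answers 0 and 1 must exclude each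
    other. *)
Lemma computes_det n (f : prec_fun n) v y z : computes f v y -> computes f v z -> y = z.
Proof.
elim: f v y z => {n} [||n i|m n f IHf g IHg|n f IHf g IHg|n f IHf] v y z /=; try by move=> -> ->.
- move=> [w [wg fw]] [w' [wg' fw']].
  have ww : w = w' by apply: eq_from_tnth => i; exact: IHg (wg i) (wg' i).
  by rewrite -ww in fw'; exact: IHf fw fw'.
- move=> [s [s0 sS ->]] [s' [s0' sS' ->]].
  have H i : i <= thead v -> s i = s' i.
    elim: i => [_|i IH iv]; first exact: IHf s0 s0'.
    by have := sS' i iv; rewrite -(IH (ltnW iv)); apply: IHg; exact: sS.
  exact: H.
- move=> [fy Hy] [fz Hz].
  have le a b : computes f [tuple of a :: v] 0 ->
      (forall i, i < b -> exists z, computes f [tuple of i :: v] z.+1) -> b <= a.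
    by move=> fa Hb; rewrite leqNgt; apply/negP => /Hb [w /(IHf _ _ _ fa)].
  by apply/eqP; rewrite eqn_leq !le.
Qed.

(** * Density of the sines of the natural numbers *)

Section Density.
Local Open Scope ring_scope.
Variable R : realType.
Implicit Types (x y e t tau : R) (n : nat) (m : int).


Lemma two_pi_gt0 : 0 < 2 * pi :> R.
Proof. by rewrite mulr_gt0 ?pi_gt0. Qed.

(** Equality would make pi the rational n / (2 m). *)
Lemma nat_neq_mul_two_pi n m : (0 < n)%N -> n%:R != m%:~R * (2 * pi) :> R.
Proof.
move=> n0; apply/eqP => E.
have m0 : m != 0.
  by apply/eqP => m0; move: E; rewrite m0 mul0r => /eqP; rewrite pnatr_eq0 -leqn0 leqNgt n0.
apply: (@pi_irrationnal R); exists (n%:Q / (m *+ 2)%:~R) => //=.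
rewrite fmorph_div /= !ratr_int -pmulrn E rmorphMn /= -[m%:~R *+ 2]mulr_natr.
by field; rewrite intr_eq0.
Qed.

(** Pigeonhole: among N + 1 multiples of 1 / tau, two have fractional parts in the same one of N
    boxes. Their difference is nonzero by [irr]. *)
Lemma small_angle tau e : 0 < tau ->
  (forall n m, (0 < n)%N -> n%:R != m%:~R * tau) -> 0 < e ->
  exists n m, 0 < `|n%:R - m%:~R * tau| < e.
Proof.
move=> t0 irr e0.
pose N := (Num.truncn (tau / e)).+1.
have N0 : (0 : R) < N%:R by rewrite ltr0n.
have tN : tau / N%:R < e.
  rewrite ltr_pdivrMr // [ltRHS]mulrC -ltr_pdivrMr //.
  exact: truncnS_gt.
pose fr n : R := n%:R / tau - (Num.floor (n%:R / tau))%:~R.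
have fr0 n : 0 <= fr n by rewrite /fr subr_ge0 floor_le.
have fr1 n : fr n < 1.
  rewrite /fr ltrBlDr addrC -[1]/(1%:~R) -intrD.
  exact: floorD1_gt.
pose bk (i : 'I_N.+1) : 'I_N := inord (Num.truncn (fr i * N%:R)).
have bkE i : (bk i : nat) = Num.truncn (fr i * N%:R).
  by rewrite /bk inordK // truncn_lt_nat ?(mulr_ge0 (fr0 _) (ltW N0)) // gtr_pMl.
have /injectivePn : ~~ injectiveb bk.
  by apply/negP => /injectiveP /leq_card; rewrite !card_ord ltnn.
case=> i [j ij bij].
wlog lij : i j ij bij / (i < j)%N.
  move=> H; have := ij; rewrite -val_eqE neq_ltn => /orP [|] h; first exact: (H i j).
  by apply: (H j i) => //; rewrite eq_sym.
exists (j - i)%N, (Num.floor (j%:R / tau) - Num.floor (i%:R / tau)).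
have -> : (j - i)%:R - (Num.floor (j%:R / tau) - Num.floor (i%:R / tau))%:~R * tau
   = (fr j - fr i) * tau.
  rewrite /fr natrB ?(ltnW lij) // intrB.
  field; exact: lt0r_neq0.
apply/andP; split.
  rewrite normr_gt0 /fr; apply/eqP => E.
  have := irr (j - i)%N (Num.floor (j%:R / tau) - Num.floor (i%:R / tau)).
  rewrite subn_gt0 => /(_ lij) /eqP; apply.
  rewrite natrB ?(ltnW lij) // intrB.
  apply/eqP; rewrite -subr_eq0 -E; apply/eqP.
  field; exact: lt0r_neq0.
rewrite normrM (gtr0_norm t0); apply: lt_trans tN.
rewrite mulrC ltr_pM2l // -[N%:R^-1]mul1r ltr_pdivlMr //.
rewrite -[X in _ * X](gtr0_norm N0) -normrM mulrBl.
have hi := fr0 i; have hj := fr0 j.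
have [|a1 a2] := andP (@truncn_itv _ (fr i * N%:R) _); first by rewrite mulr_ge0 // ltW.
have [|b1 b2] := andP (@truncn_itv _ (fr j * N%:R) _); first by rewrite mulr_ge0 // ltW.
move: a1 a2 b1 b2; rewrite -!bkE bij -natr1 => a1 a2 b1 b2.
by rewrite ltr_norml; apply/andP; split; lra.
Qed.

(** The multiples of a nonzero d with |d| < e leave gaps shorter than e, so truncating t' / d gives
    one within e of t'. *)
Lemma angle_dense tau t e : 0 < tau ->
  (forall n m, (0 < n)%N -> n%:R != m%:~R * tau) -> 0 < e ->
  exists n m, `|n%:R - t - m%:~R * tau| < e.
Proof.
move=> t0 irr e0.
have [n [m]] := small_angle t0 irr e0; set d := _ - _ => /andP [d0 de].
(* shift [t] by a multiple of the period so that [t] and [d] have the same sign *)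
pose k : int := Num.ceil (`|t| / tau).
have kt : `|t| <= k%:~R * tau by rewrite -ler_pdivrMr // ceil_ge.
pose s : int := if 0 < d then k else - k.
pose t' := t + s%:~R * tau.
have td : 0 <= t' / d.
  have [lt1 lt2] := andP (etrans (esym (ler_norml _ _)) kt).
  rewrite /t' /s; case: ltP => hd.
    by rewrite divr_ge0 ?(ltW hd) // -lerBlDr sub0r.
  by rewrite mulr_le0 ?invr_le0 // intrN mulNr subr_le0.
pose j := Num.truncn (t' / d).
have [h1 h2] := andP (truncn_itv td).
have dn0 : d != 0 by rewrite -normr_gt0.
exists (j * n)%N, (j%:Z * m + s).
have -> : (j * n)%:R - t - (j%:Z * m + s)%:~R * tau
   = (j%:R - t' / d) * d.
  rewrite mulrBl divfK // natrM intrD intrM /t' /d -[j%:~R]pmulrn.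
  by ring.
rewrite normrM.
apply: le_lt_trans de; rewrite ler_piMl //.
by rewrite ler_norml; move: h1 h2; rewrite -natr1 -/j => h1 h2; apply/andP; split; lra.
Qed.

Lemma periodic_int (f : R -> R) x m :
  trigo.periodic f (pi *+ 2) -> f (x + m%:~R * (2 * pi)) = f x.
Proof.
move=> /periodicn P; rewrite mulr_natl; case: m => n.
  by rewrite -pmulrn mulr_natl P.
by rewrite NegzE intrN mulNr -pmulrn mulr_natl -[LHS](P n.+1) subrK.
Qed.

Lemma periodic_dense (f : R -> R) t e :
  trigo.periodic f (pi *+ 2) -> {for t, continuous f} -> 0 < e ->
  exists n, `|f n%:R - f t| < e.
Proof.
move=> fP /cvgrPdist_lt fc e0.
have /nbhs_ballP [d d0 fd] := fc _ e0.
have [n [m nd]] := @angle_dense _ t d two_pi_gt0 nat_neq_mul_two_pi d0.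
exists n; rewrite distrC -[n%:R](@subrK _ (m%:~R * (2 * pi))) periodic_int //.
by apply: fd; rewrite /ball /= distrC addrAC.
Qed.

(** The angle approximated is the arcsine of the midpoint. *)
Lemma sin_nat_dense x y : -1 <= x -> y <= 1 -> x < y ->
  exists n, x < sin (n%:R : R) < y.
Proof.
move=> x1 y1 xy; pose z := (x + y) / 2.
have e0 : 0 < (y - x) / 2 by lra.
have [n] := periodic_dense (@sinD2pi R) (@continuous_sin R (asin z)) e0.
rewrite asinK; last by rewrite in_itv /= /z; lra.
by rewrite ltr_distl /z => /andP[h1 h2]; exists n; lra.
Qed.

(** Provides the tolerance of the coding as the cosine of a natural, so that an integer variable can
    carry it. *)
Lemma cos_nat_small e : 0 < e -> exists n, 0 < cos (n%:R : R) < e.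
Proof.
move=> e0; pose z := Num.min e 1 / 2.
have m0 : 0 < Num.min e 1 by rewrite lt_min e0 ltr01.
have me : Num.min e 1 <= e by rewrite ge_min lexx.
have m1 : Num.min e 1 <= 1 by rewrite ge_min lexx orbT.
have [ze z1] : z < e /\ 0 < z < 1.
  by rewrite /z; split; first lra; apply/andP; split; lra.
have [z0 _] := andP z1.
have e1 : 0 < Num.min z (e - z) by rewrite lt_min; lra.
have [n] := periodic_dense (@cosD2pi R) (@continuous_cos R (acos z)) e1.
rewrite acosK; last by rewrite in_itv /=; lra.
by rewrite lt_min !ltr_distl => /andP[h1 h2]; exists n; lra.
Qed.

(** The residue r of n modulo 2 pi lies strictly between 0 and 2 pi, so sin (r / 2) > 0, while cos r
    = 1 - 2 sin (r / 2) ^ 2. *)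
Lemma cos_nat_neq1 n : (0 < n)%N -> cos (n%:R : R) != 1.
Proof.
move=> n0; apply/eqP => cn.
pose m := Num.floor ((n%:R : R) / (2 * pi)); pose r : R := n%:R - m%:~R * (2 * pi).
have t0 := two_pi_gt0.
have r0 : 0 <= r by rewrite subr_ge0 -ler_pdivlMr // floor_le.
have r1 : r < 2 * pi.
  rewrite ltrBlDl -[X in _ + X]mul1r -mulrDl -ltr_pdivrMr //.
  by rewrite -[1]/(1%:~R) -intrD floorD1_gt.
have cr : cos r = 1.
  by rewrite -(@periodic_int cos r m) ?subrK //; exact: cosD2pi.
have {}r0 : 0 < r.
  by rewrite lt_neqAle r0 andbT eq_sym subr_eq0 nat_neq_mul_two_pi.
have : 0 < sin (r / 2) by apply: sin_gt0_pi; lra.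
have := cos_mulr2n (r / 2).
have -> : r / 2 *+ 2 = r by rewrite -mulr_natr divfK ?pnatr_eq0.
rewrite cr cos2sin2 => h.
have /eqP : sin (r / 2) ^+ 2 = 0 by lra.
by rewrite sqrf_eq0 => /eqP ->; rewrite ltxx.
Qed.

(** Equal cosines force equal or opposite sines, hence cos (n - k) = 1 or cos (n + k) = 1. *)
Lemma cos_nat_inj (k n : nat) : cos (k%:R : R) = cos n%:R -> k = n.
Proof.
wlog le_kn : k n / (k <= n)%N.
  move=> H; case: (leqP k n) => h; first exact: H.
  by move=> /esym /H -> //; exact: ltnW.
move=> E; have /eqP : sin (k%:R : R) ^+ 2 = sin (n%:R : R) ^+ 2.
  by rewrite !sin2cos2 E.
have C := cos2Dsin2 (n%:R : R).
rewrite eqf_sqr => /orP [] /eqP S.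
  have h : cos ((n - k)%:R : R) = 1 by rewrite natrB // cosB E S -!expr2.
  case: (posnP (n - k)) => [|/cos_nat_neq1 /eqP] // /eqP; rewrite subn_eq0 => ?.
  by apply/eqP; rewrite eqn_leq le_kn.
have h : cos ((n + k)%:R : R) = 1.
  by rewrite natrD cosD E S mulrN opprK -!expr2.
case: (posnP (n + k)) => [|/cos_nat_neq1 /eqP] //.
by move=> /eqP; rewrite addn_eq0 => /andP [/eqP -> /eqP ->].
Qed.
End Density.

(** * Coding finite lists by sines *)

Section Coding.
Local Open Scope ring_scope.

Lemma common_lower_bound (R : realType) (I : finType) (f : I -> R) :
  (forall k, 0 < f k) -> exists2 e, 0 < e & forall k, e <= f k.
Proof.
move=> f0.
suff [e e0 H] : exists2 e, 0 < e & forall k, k \in enum I -> e <= f k.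
  by exists e => // k; apply: H; rewrite mem_enum.
elim: (enum I) => [|k r [e e0 H]]; first by exists 1.
exists (Num.min (f k) e); first by rewrite lt_min f0.
move=> l; rewrite inE => /orP [/eqP->|/H h]; first by rewrite ge_min lexx.
by rewrite ge_min h orbT.
Qed.

Variables (R : realType) (I : finType).
Implicit Types (c t u x y : R) (v p q : I -> R) (b w : I -> nat).
Implicit Types (L : seq (I -> nat)) (al : seq nat).

Local Notation s j := (sin (j%:R : R)).

(** The reals c, v k and t stand for sin C, sin V_k and cos Y; they stay arbitrary here because the
    construction first confines c and v to open windows. *)
Definition approx c v t (a : nat) b w :=
  s a < c /\
  forall k, `|v k - s (b k) - (c - s a) * cos (w k)%:R| < (c - s a) * t.

(** A single j tests that a is a record and that each b k is least, so one universal integer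
    quantifier expresses all the minimality conditions. *)
Definition leastness c v (a : nat) b (j : nat) :=
  ((j < a)%N -> ~~ (s a <= s j < c)) /\
  forall k, (j < b k)%N -> 2 * (c - s a) <= `|v k - s j|.

Definition coded c v t a b w :=
  approx c v t a b w /\ forall j, leastness c v a b j.

(** The second clause makes decoding unambiguous below a; the bound B restricts it to values whose
    cosines the tolerance t separates. The third says that a is itself a record, ready for the next
    element. *)
Definition codes c v t (B : nat) L al (a : nat) :=
  [/\ forall i, (i < size L)%N -> exists b, coded c v t (nth 0%N al i) b (nth (fun=> 0%N) L i),
      forall a' b w, (a' < a)%N -> (forall k, (w k <= B)%N) -> coded c v t a' b w ->
        exists2 i, (i < size L)%N & a' = nth 0%N al i /\ w = nth (fun=> 0%N) L i &
      forall j, (j < a)%N -> ~~ (s a <= s j < c)].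

(* The windows []s a, u[] for c and []p k, q k[] for [v k] are kept open, so that c and v
   can be moved to the next element of the list. *)
Lemma codes_exist t (B : nat) L :
  0 < t <= 1 ->
  (forall m n, (m <= B)%N -> (n <= B)%N -> `|cos (m%:R : R) - cos n%:R| < 2 * t -> m = n) ->
  (forall i k, (i < size L)%N -> (nth (fun=> 0%N) L i k <= B)%N) ->
  exists al a u p q,
  [/\ size al = size L, sorted ltn (rcons al a), s a < u <= 1,
      forall k, [&& -1 <= p k, p k < q k & q k <= 1] &
      forall c v, s a < c < u -> (forall k, p k < v k < q k) -> codes c v t B L al a].
Proof.
move=> /andP [t0 t1] sep.
elim/last_ind: L => [_|L w IH wB].
  (* The record 0 has no naturals below it, so nothing is decoded. *)
  exists [::], 0%N, 1, (fun=> -1), (fun=> 1); split => //.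
  - by rewrite sin0 ltr01 lexx.
  - by move=> k; rewrite !lexx /= andbT; lra.
have LB i k : (i < size L)%N -> (nth (fun=> 0%N) L i k <= B)%N.
  move=> iL; have := wB i k; rewrite size_rcons nth_rcons iL; apply.
  exact: ltnW.
have [al [a [u [p [q [al_size al_sorted /andP [sau u1] pq H]]]]]] := IH LB.
have wleB k : (w k <= B)%N.
  by have := wB (size L) k; rewrite size_rcons nth_rcons ltnn eqxx; apply.
have /choice [b bP] : forall k, exists n, p k < s n < q k /\
    forall j, (j < n)%N -> ~~ (p k < s j < q k).
  move=> k; have := pq k => /and3P [p1 pqk q1].
  have /ex_minnP [n np nmin] := sin_nat_dense p1 q1 pqk.
  by exists n; split => // j; apply: contraTN => /nmin; rewrite -leqNgt.
have [e1 e10 e1P] : exists2 e, 0 < e & forall k,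
    e <= Num.min (s (b k) - p k) (q k - s (b k)).
  apply: common_lower_bound => k; have [/andP [h1 h2] _] := bP k.
  by rewrite lt_min !subr_gt0 h1.
(* The quarter of the margin keeps the sines of all j < b k at distance at least 4 d from sin (b k);
   the second bound keeps the next record below u. *)
pose d := Num.min (e1 / 4) (u - s a).
have d0 : 0 < d by rewrite lt_min subr_gt0 sau divr_gt0.
have du : d <= u - s a by rewrite ge_min lexx orbT.
have dp k : p k <= s (b k) - 4 * d.
  have := e1P k; rewrite le_min => /andP [h _].
  have : d <= e1 / 4 by rewrite ge_min lexx.
  move: h; clear; lra.
have dq k : s (b k) + 4 * d <= q k.
  have := e1P k; rewrite le_min => /andP [_ h].
  have : d <= e1 / 4 by rewrite ge_min lexx.
  move: h; clear; lra.
have bfar k j : (j < b k)%N -> 4 * d <= `|s (b k) - s j|.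
  move=> jb; have [_ /(_ j jb)] := bP k.
  rewrite negb_and -!leNgt => /orP [] h.
    by rewrite ler_normr; apply/orP; left; move: (dp k) h; clear; lra.
  by rewrite ler_normr; apply/orP; right; move: (dq k) h; clear; lra.
have [e /andP [ea ed] emin] : exists2 n, s a < s n < s a + d &
    forall j, (j < n)%N -> ~~ (s a < s j < s a + d).
  have h1 : -1 <= s a by exact: sin_geN1.
  have h2 : s a + d <= 1 by move: du u1; clear; lra.
  have h3 : s a < s a + d by rewrite ltrDl.
  have /ex_minnP [n np nmin] := sin_nat_dense h1 h2 h3.
  by exists n => // j; apply: contraTN => /nmin; rewrite -leqNgt.
(* The midpoints are admissible values of v, from which the clause of [H] about c alone can be
   extracted. *)
have pmid k : p k < (p k + q k) / 2 < q k.
  have /and3P [_ h _] := pq k; move: h; clear => h; apply/andP; split; lra.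
have rec_a j : (j < a)%N -> ~~ (s a <= s j < u).
  move=> ja; apply/negP => /andP [h1 h2].
  have hc : s a < (s j + u) / 2 < u by move: h1 h2 sau; clear => *; apply/andP; split; lra.
  have [_ _ /(_ j ja) /negP] := H _ _ hc pmid; apply.
  by rewrite h1; move: h2; clear; lra.
have ae : (a < e)%N.
  rewrite ltnNge leq_eqVlt; apply/negP => /orP [/eqP ea'|ea'].
    by move: ea; rewrite ea' ltxx.
  by have /negP := rec_a e ea'; apply; rewrite ltW //=; move: ed du; clear; lra.
pose h := s e - s a.
have h0 : 0 < h by rewrite subr_gt0.
have hd : h < d by rewrite /h; move: ed; clear; lra.
(* Half of the tolerance h t absorbs the error of c against sin e, the other half that of v k
   against m k. *)
pose u' := Num.min (s a + d) (s e + h * t / 2).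
have ht0 : 0 < h * t by rewrite mulr_gt0.
have seu' : s e < u' by rewrite lt_min ed; move: ht0; clear; lra.
have u'd : u' <= s a + d by rewrite ge_min lexx.
have u'h : u' <= s e + h * t / 2 by rewrite ge_min lexx orbT.
pose m k := s (b k) + h * cos (w k)%:R.
have mb k : `|m k - s (b k)| <= h.
  rewrite /m addrAC subrr add0r normrM (gtr0_norm h0) ler_piMr ?(ltW h0) //.
  exact: cos_max.
(* The old record a now carries w, and e is the next one. *)
exists (rcons al a), e, u', (fun k => m k - h * t / 2), (fun k => m k + h * t / 2).
have htd : h * t <= h by rewrite ler_piMr // ltW.
split.
- by rewrite !size_rcons al_size.
- case: (al) al_sorted => [|x r] /=; first by rewrite andbT.
  by rewrite !rcons_path last_rcons => ->.
- by rewrite seu' /=; move: u'd du u1; clear; lra.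
- move=> k; have := mb k; rewrite ler_norml => /andP [h1 h2].
  have /and3P [h3 _ h4] := pq k.
  move: (dp k) (dq k) htd hd ht0 h1 h2 h3 h4; clear => *.
  by apply/and3P; split; lra.
move=> c v /andP [ec cu'] vm.
have cau : s a < c < u.
  by move: ec cu' ea u'd du; clear => *; apply/andP; split; lra.
have vpq k : p k < v k < q k.
  have /andP [h7 h8] := vm k; have := mb k; rewrite ler_norml => /andP [h1 h2].
  move: (dp k) (dq k) htd hd h1 h2 h7 h8; clear => *.
  by apply/andP; split; lra.
have [H1 H2 H3] := H c v cau vpq.
have ca : 0 < c - s a by case/andP: cau; rewrite subr_gt0.
have hca : h < c - s a by rewrite /h; move: ec; clear; lra.
have cad : c - s a < d by move: cu' u'd; clear; lra.
have vb k : `|v k - s (b k)| < 2 * h.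
  have /andP [h7 h8] := vm k; have := mb k; rewrite ler_norml => /andP [h1 h2].
  move: htd h0 h1 h2 h7 h8; clear => *.
  by rewrite ltr_norml; apply/andP; split; lra.
have vmc k : `|v k - s (b k) - (c - s a) * cos (w k)%:R| < (c - s a) * t.
  have /andP [h7 h8] := vm k.
  have -> : v k - s (b k) - (c - s a) * cos (w k)%:R
    = (v k - m k) - (c - s e) * cos (w k)%:R by rewrite /m /h; ring.
  have h9 : `|(c - s e) * cos (w k)%:R| <= h * t / 2.
    rewrite normrM; apply: (@le_trans _ _ (`|c - s e| * 1)).
      by apply: ler_wpM2l => //; exact: cos_max.
    by rewrite mulr1 gtr0_norm; move: ec cu' u'h; clear; lra.
  have h10 : `|v k - m k| < h * t / 2.
    by rewrite ltr_norml; move: h7 h8; clear => *; apply/andP; split; lra.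
  have h11 : h * t < (c - s a) * t by rewrite ltr_pM2r.
  apply: le_lt_trans h11; apply: le_trans (ler_normB _ _) _.
  by rewrite [leRHS](splitr); apply: lerD => //; exact: ltW.
have new_coded : coded c v t a b w.
  split; first by split => //; case/andP: cau.
  move=> j; split; first exact: H3.
  move=> k jb; have := bfar k j jb; have := vb k.
  have := ler_normB (v k - s j) (v k - s (b k)).
  have -> : v k - s j - (v k - s (b k)) = s (b k) - s j by ring.
  move: hd hca cad; clear; lra.
have aL : nth 0%N (rcons al a) (size L) = a by rewrite -al_size nth_rcons ltnn eqxx.
split.
- move=> i; rewrite size_rcons ltnS leq_eqVlt => /orP [/eqP ->|iL].
    by exists b; rewrite aL nth_rcons ltnn eqxx.
  by have [b' hb'] := H1 i iL; exists b'; rewrite !nth_rcons al_size iL.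
- move=> a' b' w' a'e w'B C; rewrite size_rcons.
  case: (ltngtP a' a) => a'a.
  + have [i iL [ai wi]] := H2 a' b' w' a'a w'B C.
    by exists i; [exact: ltnW | rewrite !nth_rcons al_size iL].
  (* No record lies strictly between a and e: testing a' against a puts sin a' between sin a and c,
     against the minimality of e. *)
  + have [[h1 _] /(_ a) [/(_ a'a) h2 _]] := C.
    have /negP := emin a' a'e; case.
    move: h2; rewrite (andP cau).1 andbT -ltNge => ->.
    by move: h1 cad => /=; clear; lra.
  + subst a'; exists (size L) => //; rewrite aL; split => //.
    rewrite nth_rcons ltnn eqxx; apply: funext => k.
    have [[_ /(_ k) h1] h2] := C.
    (* As both sines are this close to v k, leastness of b and of b' forces them to agree. *)
    have vb' : `|v k - s (b' k)| < 2 * (c - s a).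
      have h3 : `|(c - s a) * cos (w' k)%:R| <= c - s a.
        rewrite normrM gtr0_norm // ler_piMr ?(ltW ca) //; exact: cos_max.
      have h4 : (c - s a) * t <= c - s a by rewrite ler_piMr // ltW.
      have := ler_normD (v k - s (b' k) - (c - s a) * cos (w' k)%:R) ((c - s a) * cos (w' k)%:R).
      rewrite subrK; move: h1 h3 h4; clear; lra.
    have bb' : b' k = b k.
      case: (ltngtP (b' k) (b k)) => // lt; exfalso.
        have [_ hb] := new_coded; have [_ /(_ k lt)] := hb (b' k).
        by move: vb'; clear; lra.
      have [_ /(_ k lt)] := h2 (b k); move: (vb k) hca; clear; lra.
    (* With the same b, the two approximations put the cosines less than 2 t apart. *)
    apply: sep => //.
    rewrite -(@ltr_pM2l _ (c - s a)) // -[X in X * `|_|](gtr0_norm ca) -normrM.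
    have := vmc k; rewrite bb' in h1.
    have := ler_normB (v k - s (b k) - (c - s a) * cos (w k)%:R)
      (v k - s (b k) - (c - s a) * cos (w' k)%:R).
    have -> : v k - s (b k) - (c - s a) * cos (w k)%:R -
        (v k - s (b k) - (c - s a) * cos (w' k)%:R)
      = (c - s a) * (cos (w' k)%:R - cos (w k)%:R) by ring.
    move: h1; clear; lra.
- move=> j je; apply/negP => /andP [h1 h2].
  by have /negP := emin j je; apply; move: h1 h2 cu' u'd ea; clear => *; apply/andP; split; lra.
Qed.


(** Finitely many cosines, pairwise distinct by [cos_nat_inj]; the value 1 of [f] on the diagonal
    only keeps it positive. *)
Lemma cos_separation (B : nat) :
  exists2 t : R, 0 < t <= 1 &
  forall m n, (m <= B)%N -> (n <= B)%N -> `|cos (m%:R : R) - cos n%:R| < 2 * t -> m = n.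
Proof.
pose f (x : 'I_B.+1 * 'I_B.+1) : R :=
  if x.1 == x.2 then 1 else `|cos (x.1%:R : R) - cos x.2%:R| / 2.
have [x|e e0 ef] := @common_lower_bound _ _ f.
  rewrite /f; case: eqP => // x12; rewrite divr_gt0 // normr_gt0 subr_eq0.
  by apply/eqP => /cos_nat_inj /val_inj.
exists (Num.min e 1).
  by rewrite lt_min e0 ltr01 /= ge_min lexx orbT.
move=> m n mB nB; apply: contraTeq => mn; rewrite -leNgt.
have := ef (inord m, inord n); rewrite /f /= !inordK // -val_eqE /= !inordK // (negbTE mn).
have : Num.min e 1 <= e by rewrite ge_min lexx.
lra.
Qed.

Lemma list_bound L : exists B, forall i k, (i < size L)%N -> (nth (fun=> 0%N) L i k <= B)%N.
Proof.
elim: L => [|w L [B LB]]; first by exists 0%N.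
exists (B + \sum_k w k)%N => -[|i] k /= iL; last exact: leq_trans (LB i k iL) (leq_addr _ _).
by rewrite (bigD1 k) //= addnCA leq_addr.
Qed.

(** By density the open windows contain sines of naturals, so all real parameters become sines or
    cosines of naturals. *)
Lemma list_coded L : exists C Y A B V al,
  [/\ size al = size L, sorted ltn (rcons al A),
      forall i k, (i < size L)%N -> (nth (fun=> 0%N) L i k <= B)%N &
      codes (s C) (fun k => s (V k)) (cos Y%:R) B L al A].
Proof.
have [B LB] := list_bound L.
have [t /andP [t0 t1] sep] := cos_separation B.
have [Y /andP [Y0 Yt]] := cos_nat_small t0.
have [||al [a [u [p [q [al_size al_sorted /andP [sau u1] pq H]]]]]] :=
    @codes_exist (cos Y%:R) B L _ _ LB.
- by rewrite Y0 cos_le1.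
- move=> m n mB nB h; apply: sep => //; apply: lt_trans h _; lra.
have [C Cau] := sin_nat_dense (sin_geN1 _) u1 sau.
have /choice [V Vpq] : forall k, exists n, p k < s n < q k.
  by move=> k; have /and3P [h1 h2 h3] := pq k; exact: sin_nat_dense.
by exists C, Y, a, B, V, al; split => //; exact: H.
Qed.
End Coding.

(** * Sentences *)

Section Formulas.
Local Open Scope ring_scope.
Variables (R : realType) (n : nat).
Implicit Types (x : 'rV[int]_n) (t : term n) (phi : qf_formula n).

Definition tsub t1 t2 := TAdd t1 (TScale (- 1) t2).
Definition tnat (m : nat) : term n := TScale m%:~R TOne.
(* 2 (sin c - sin a) cos y, without a product. *)
Definition tprod c a y :=
  tsub (TAdd (TSin (TAdd c y)) (TSin (tsub c y))) (TAdd (TSin (TAdd a y)) (TSin (tsub a y))).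
Definition fle t1 t2 := FNot (FLt t2 t1).
Definition fabslt t1 t2 := FAnd (FLt t1 t2) (FLt (TScale (- 1) t2) t1).
Definition fimp phi1 phi2 := FOr (FNot phi1) phi2.
Definition fall (T : Type) (l : seq T) (F : T -> qf_formula n) :=
  foldr (fun a => FAnd (F a)) (FEq TZero TZero) l.
Definition fex (T : Type) (l : seq T) (F : T -> qf_formula n) :=
  foldr (fun a => FOr (F a)) (FLt TZero TZero) l.

Lemma eval_tsub x t1 t2 : eval_term R x (tsub t1 t2) = eval_term R x t1 - eval_term R x t2.
Proof. by rewrite /= rmorphN1 mulN1r. Qed.

Lemma eval_tnat x m : eval_term R x (tnat m) = m%:R.
Proof. by rewrite /= ratr_int mulr1. Qed.

Lemma eval_tprod x c a y : eval_term R x (tprod c a y) =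
  2 * ((sin (eval_term R x c) - sin (eval_term R x a)) * cos (eval_term R x y)).
Proof.
rewrite eval_tsub /= rmorphN1 !mulN1r !sinD sinN cosN.
ring.
Qed.

Lemma holds_fle x t1 t2 : qf_holds R x (fle t1 t2) <-> eval_term R x t1 <= eval_term R x t2.
Proof. by rewrite /= leNgt; split=> /negP. Qed.

Lemma holds_fabslt x t1 t2 :
  qf_holds R x (fabslt t1 t2) <-> `|eval_term R x t1| < eval_term R x t2.
Proof.
by rewrite /= rmorphN1 mulN1r ltr_norml; split=> [[-> ->]|/andP [-> ->]].
Qed.

Lemma holds_fimp x phi1 phi2 :
  qf_holds R x (fimp phi1 phi2) <-> (qf_holds R x phi1 -> qf_holds R x phi2).
Proof.
split=> [[h1 /h1|h2] //|h]; have [h1|h1] := pselect (qf_holds R x phi1); last by left.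
by right; exact: h.
Qed.

Lemma holds_fall (T : eqType) x (l : seq T) F :
  qf_holds R x (fall l F) <-> forall a, a \in l -> qf_holds R x (F a).
Proof.
elim: l => [|b l IH] /=; first by split.
rewrite IH; split=> [[Fb Fl] a|H].
  by rewrite inE => /orP [/eqP ->|/Fl].
by split=> [|a al]; apply: H; rewrite inE ?eqxx ?al ?orbT.
Qed.

Lemma holds_fall_ord x d (F : 'I_d -> qf_formula n) :
  qf_holds R x (fall (enum 'I_d) F) <-> forall k, qf_holds R x (F k).
Proof. by rewrite holds_fall; split=> H k; [apply: H; rewrite mem_enum | move=> _]. Qed.

Lemma holds_fex (T : eqType) x (l : seq T) F :
  qf_holds R x (fex l F) <-> exists2 a, a \in l & qf_holds R x (F a).
Proof.
elim: l => [|b l IH] /=; first by split=> [|[]] //; rewrite ltxx.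
rewrite IH; split=> [[Fb|[a al Fa]]|[a]].
- by exists b; rewrite ?mem_head.
- by exists a; rewrite // inE al orbT.
- by rewrite inE => /orP [/eqP -> ?|al Fa]; [left | right; exists a].
Qed.
End Formulas.

(* A slot is a triple (a, b, w) of an integer and two families of four integers.  In a block of
   variables, slot p occupies the nine coordinates starting at 9 p. *)
Record slot (T : Type) := Slot { slot_a : T; slot_b : 'I_4 -> T; slot_w : 'I_4 -> T }.

Definition slot_map T T' (f : T -> T') (s : slot T) : slot T' :=
  Slot (f (slot_a s)) (f \o slot_b s) (f \o slot_w s).

Definition slot_coord (p o : nat) : nat := (9 * p + o)%N.

Section Slots.
Local Open Scope ring_scope.
Variable K : nat.
Local Notation N := (sumn [:: K.+1; K.+1; K.+1; K.+1]).

Definition vidx (blk i : nat) : 'I_N :=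
  match blk with
  | 0 => lshift _ (inord i)
  | 1 => rshift _ (lshift _ (inord i))
  | 2 => rshift _ (rshift _ (lshift _ (inord i)))
  | _ => rshift _ (rshift _ (rshift _ (lshift _ (inord i))))
  end.

Definition tv (blk i : nat) : term N := TVar (vidx blk i).

Definition tslot (blk p : nat) : slot (term N) :=
  Slot (tv blk (slot_coord p 0)) (fun k => tv blk (slot_coord p k.+1))
    (fun k => tv blk (slot_coord p (k + 5))).

Definition zslot (y : 'rV[int]_K.+1) (p : nat) : slot int :=
  Slot (y 0 (inord (slot_coord p 0))) (fun k => y 0 (inord (slot_coord p k.+1)))
    (fun k => y 0 (inord (slot_coord p (k + 5)))).

(** Inverse to [zslot]: in each group of nine coordinates, offset 0 is a, 1 to 4 are b, and 5 to 8
    are w. *)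
Definition block_of (s : nat -> slot int) : 'rV[int]_K.+1 :=
  \row_(i < K.+1)
    let: (p, o) := (i %/ 9, i %% 9)%N in
    if o == 0%N then slot_a (s p)
    else if (o < 5)%N then slot_b (s p) (inord o.-1) else slot_w (s p) (inord (o - 5)).

Lemma zslot_block_of s p : (9 * p + 8 <= K)%N -> zslot (block_of s) p = s p.
Proof.
move=> pK; rewrite /zslot /slot_coord.
have E o : (o < 9)%N -> block_of s 0 (inord (9 * p + o)) =
    if o == 0%N then slot_a (s p)
    else if (o < 5)%N then slot_b (s p) (inord o.-1) else slot_w (s p) (inord (o - 5)).
  move=> o9; rewrite mxE inordK; last by lia.
  by rewrite [(9 * p)%N]mulnC divnMDl // modnMDl divn_small // modn_small // addn0.
transitivity (Slot (slot_a (s p)) (slot_b (s p)) (slot_w (s p))); last by case: (s p).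
rewrite E //; congr Slot; apply: funext => k.
- rewrite E; last by have := ltn_ord k; lia.
  by rewrite ltnS ltn_ord /= inord_val.
- rewrite E; last by have := ltn_ord k; lia.
  by rewrite addn_eq0 andbF addnK ltnNge leq_addl /= inord_val.
Qed.

(** The final 0 is the empty row from the base case of [quantify]. *)
Definition env (y1 y2 y3 y4 : 'rV[int]_K.+1) : 'rV[int]_N :=
  row_mx y1 (row_mx y2 (row_mx y3 (row_mx y4 0))).

Lemma eval_tslot R y1 y2 y3 y4 blk p : (blk < 4)%N ->
  slot_map (eval_term R (env y1 y2 y3 y4)) (tslot blk p) =
  slot_map intr (zslot (nth y1 [:: y1; y2; y3; y4] blk) p).
Proof.
have E i : (blk < 4)%N -> env y1 y2 y3 y4 0 (vidx blk i) =
    nth y1 [:: y1; y2; y3; y4] blk 0 (inord i).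
  case: blk => [|[|[|[|]]]] // _; rewrite /env /vidx.
  - exact: row_mxEl.
  - by rewrite row_mxEr; exact: row_mxEl.
  - by rewrite row_mxEr row_mxEr; exact: row_mxEl.
  - by rewrite row_mxEr row_mxEr row_mxEr; exact: row_mxEl.
move=> h; rewrite /slot_map /tslot /zslot /=.
by congr Slot; [rewrite E | apply: funext => k /=; rewrite E..].
Qed.

Lemma holds_EAEA (R : realType) (phi : qf_formula N) :
  holds R (@Sentence QExists [:: K.+1; K.+1; K.+1; K.+1] phi) <->
  exists y1, forall y2, exists y3, forall y4, qf_holds R (env y1 y2 y3 y4) phi.
Proof. by []. Qed.
End Slots.

Arguments qf_holds : simpl never.

(** * Membership in the coded list as a formula *)

Section Membership.
Local Open Scope ring_scope.

(* In the slot [prm] of parameters, the four entries of [slot_b] are C, Y and the bounds on the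
   positions and on the values; the entries of [slot_w] are the V k. *)
Definition in_approx (R : realType) (prm s : slot R) : Prop :=
  let: Slot _ q V := prm in let: Slot a b w := s in
  [/\ 0 <= a < q FB,
      forall k, [&& 0 <= b k, 0 <= w k & w k <= q FC],
      sin a < sin (q TAG) &
      forall k, `|sin (V k) - sin (b k) - (sin (q TAG) - sin a) * cos (w k)| <
        (sin (q TAG) - sin a) * cos (q FA)].

(** The guards 0 <= j make negative tests vacuous, since j will range over all integers. *)
Definition in_least (R : realType) (prm s : slot R) (j : R) : Prop :=
  let: Slot _ q V := prm in let: Slot a b w := s in
  (0 <= j < a -> ~~ (sin a <= sin j < sin (q TAG))) /\
  forall k, 0 <= j < b k -> 2 * (sin (q TAG) - sin a) <= `|sin (V k) - sin j|.

(** The inequality of [in_approx] is doubled, because [tprod] denotes twice a product. *)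
Definition fapprox n (prm s : slot (term n)) : qf_formula n :=
  let: Slot _ q V := prm in let: Slot a b w := s in
  FAnd (FAnd (fle TZero a) (FLt a (q FB)))
  (FAnd (fall (enum 'I_4) (fun k =>
           FAnd (fle TZero (b k)) (FAnd (fle TZero (w k)) (fle (w k) (q FC)))))
  (FAnd (FLt (TSin a) (TSin (q TAG)))
        (fall (enum 'I_4) (fun k =>
           fabslt (tsub (TScale 2 (tsub (TSin (V k)) (TSin (b k)))) (tprod (q TAG) a (w k)))
                  (tprod (q TAG) a (q FA)))))).

Definition fleast n (prm s : slot (term n)) (j : term n) : qf_formula n :=
  let: Slot _ q V := prm in let: Slot a b w := s in
  FAnd (fimp (FAnd (fle TZero j) (FLt j a))
             (FNot (FAnd (fle (TSin a) (TSin j)) (FLt (TSin j) (TSin (q TAG))))))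
       (fall (enum 'I_4) (fun k =>
          fimp (FAnd (fle TZero j) (FLt j (b k)))
               (FNot (fabslt (tsub (TSin (V k)) (TSin j))
                             (TScale 2 (tsub (TSin (q TAG)) (TSin a))))))).

Lemma eval_two (R : realType) n (x : 'rV[int]_n) t :
  eval_term R x (TScale 2 t) = 2 * eval_term R x t.
Proof. by rewrite /= ratr_nat. Qed.

Lemma holds_fand (R : realType) n (x : 'rV[int]_n) phi psi :
  qf_holds R x (FAnd phi psi) <-> qf_holds R x phi /\ qf_holds R x psi.
Proof. by []. Qed.

Lemma holds_fnot (R : realType) n (x : 'rV[int]_n) phi :
  qf_holds R x (FNot phi) <-> ~ qf_holds R x phi.
Proof. by []. Qed.

Lemma holds_fapprox (R : realType) n (x : 'rV[int]_n) prm s :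
  qf_holds R x (fapprox prm s) <->
  in_approx (slot_map (eval_term R x) prm) (slot_map (eval_term R x) s).
Proof.
case: prm s => [c q V] [a b w]; rewrite /fapprox /in_approx /slot_map /=.
rewrite !holds_fand !holds_fall_ord; split.
  move=> [[/holds_fle a0 aA] [bw [ac app]]]; split => //.
  - by rewrite a0 aA.
  - by move=> k; have [/holds_fle -> [/holds_fle -> /holds_fle ->]] := bw k.
  - move=> k; have /holds_fabslt := app k.
    rewrite eval_tsub eval_two eval_tsub !eval_tprod /= -mulrBr normrM ger0_norm //.
    by rewrite ltr_pM2l.
move=> [/andP [a0 aA] bw ac app]; split; first by split; [apply/holds_fle|].
split; first by move=> k; have /and3P [h1 h2 h3] := bw k; split; [|split]; exact/holds_fle.
split=> // k; apply/holds_fabslt.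
rewrite eval_tsub eval_two eval_tsub !eval_tprod /= -mulrBr normrM ger0_norm //.
by rewrite ltr_pM2l.
Qed.

Lemma holds_fleast (R : realType) n (x : 'rV[int]_n) prm s j :
  qf_holds R x (fleast prm s j) <->
  in_least (slot_map (eval_term R x) prm) (slot_map (eval_term R x) s) (eval_term R x j).
Proof.
case: prm s => [c q V] [a b w]; rewrite /fleast /in_least /slot_map.
rewrite holds_fand holds_fimp holds_fall_ord; split=> [[h1 h2]|[h1 h2]]; split.
- move=> /andP [/(holds_fle R x TZero j) j0 ja]; apply/negP => /andP [h3 h4].
  have /holds_fnot := h1 (conj j0 ja); apply.
  by apply/holds_fand; split=> //; exact/holds_fle.
- move=> k /andP [/(holds_fle R x TZero j) j0 jb]; rewrite leNgt; apply/negP => h3.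
  have /holds_fimp/(_ (conj j0 jb))/holds_fnot := h2 k; apply.
  by apply/holds_fabslt; rewrite eval_two !eval_tsub.
- move=> [/holds_fle j0 ja]; apply/holds_fnot => -[/holds_fle h3 h4].
  by have /negP := h1 (introT andP (conj j0 ja)); apply; rewrite /= in h3 h4 *; rewrite h3.
- move=> k; apply/holds_fimp => -[/holds_fle j0 jb]; apply/holds_fnot => /holds_fabslt.
  rewrite eval_two !eval_tsub ltNge /= => /negP; apply.
  by apply: h2; rewrite /= j0.
Qed.

Definition natr_slot (R : realType) (s : slot nat) : slot R := slot_map (fun m => m%:R) s.

Lemma slot_map_absz (R : realType) (s : slot int) :
  0 <= slot_a s -> (forall k, 0 <= slot_b s k) -> (forall k, 0 <= slot_w s k) ->
  slot_map intr s = natr_slot R (slot_map absz s).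
Proof.
have E (z : int) : 0 <= z -> z%:~R = (`|z|%N)%:R :> R by move=> z0; rewrite natr_absz ger0_norm.
case: s => a b w /= a0 b0 w0; rewrite /natr_slot /slot_map /=.
by congr Slot; [exact: E | apply: funext => k /=; exact: E..].
Qed.

Lemma in_approx_ge0 (R : realType) (prm : slot R) (s : slot int) :
  in_approx prm (slot_map intr s) ->
  [/\ 0 <= slot_a s, forall k, 0 <= slot_b s k & forall k, 0 <= slot_w s k].
Proof.
case: prm s => [c q V] [a b w] [/andP [a0 _] bw _ _] /=; split.
- by rewrite ler0z in a0.
- by move=> k; have /and3P [h _ _] := bw k; rewrite /= ler0z in h.
- by move=> k; have /and3P [_ h _] := bw k; rewrite /= ler0z in h.
Qed.

Lemma in_coded (R : realType) (prm s : slot nat) :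
  (in_approx (natr_slot R prm) (natr_slot R s) /\
   forall j : int, in_least (natr_slot R prm) (natr_slot R s) j%:~R) <->
  [/\ (slot_a s < slot_b prm FB)%N, forall k, (slot_w s k <= slot_b prm FC)%N &
      coded (sin (slot_b prm TAG)%:R) (fun k => sin (slot_w prm k)%:R)
        (cos (slot_b prm FA)%:R : R) (slot_a s) (slot_b s) (slot_w s)].
Proof.
case: prm s => [c q V] [a b w]; rewrite /natr_slot /slot_map /=; split.
  move=> [[/andP [_ aA] bw ac app] least]; split.
  - by rewrite ltr_nat in aA.
  - by move=> k; have /and3P [_ _] := bw k; rewrite /= ler_nat.
  split; first by split.
  move=> j; have [h1 h2] := least j; split.
    by move=> ja; apply: h1; rewrite ler0z /= -pmulrn ltr_nat.
  by move=> k jb; apply: h2; rewrite ler0z /= -pmulrn ltr_nat.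
move=> [aA wB [[ac app] least]]; split.
  split => //; first by rewrite ler0n ltr_nat.
  by move=> k; rewrite /= !ler0n ler_nat wB.
move=> j; split.
  case/andP; rewrite ler0z; case: j => // j _; rewrite -pmulrn ltr_nat.
  by have [h _] := least j; exact: h.
move=> k /= /andP []; rewrite ler0z; case: j => // j _; rewrite -pmulrn ltr_nat.
by have [_ h] := least j; exact: h.
Qed.
End Membership.

(** * The sentence expressing provability *)

Section Sentences.
Local Open Scope ring_scope.
Variable K : nat.
Local Notation N := (sumn [:: K.+1; K.+1; K.+1; K.+1]).
Variable RS : seq rule.

(* Block 0: the input, the parameters and the goal; block 1: a member and a test of the goal;
   block 2: a test of the member, the rule justifying it and the premises; block 3: a test of
   the premises. *)
Definition entry_term (i : nat) (k : 'I_4) : term N :=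
  slot_w (if i == 0%N then tslot K 1 0 else tslot K 2 i) k.

(** The sign conditions let an equation between integers pass to their absolute values. *)
Definition feqn (e : equation) : qf_formula N :=
  let: (l, m, r, n) := e in
  FAnd (fle TZero (entry_term l.1 l.2)) (FAnd (fle TZero (entry_term r.1 r.2))
    (FEq (entry_term l.1 l.2) (TAdd (TScale m%:~R (entry_term r.1 r.2)) (tnat _ n)))).

(** The index i is stored in block 2, hence chosen before block 3: the same rule must survive every
    test of its premises. *)
Definition frule (i : nat) : qf_formula N :=
  let r := nth (0%N, [::]) RS i in
  FAnd (FEq (slot_b (tslot K 2 0) TAG) (tnat _ i))
  (FAnd (fall (iota 1 r.1) (fun p =>
           FAnd (fapprox (tslot K 0 0) (tslot K 2 p))
          (FAnd (fleast (tslot K 0 0) (tslot K 2 p) (slot_a (tslot K 3 0)))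
                (FLt (slot_a (tslot K 2 p)) (slot_a (tslot K 1 0))))))
        (fall r.2 feqn)).

Definition fgoal : qf_formula N :=
  FAnd (fapprox (tslot K 0 0) (tslot K 0 1))
  (FAnd (fleast (tslot K 0 0) (tslot K 0 1) (slot_a (tslot K 1 1)))
        (fall (enum 'I_4) (fun k => FEq (slot_w (tslot K 0 1) k)
           (nth TZero [:: tnat _ 1; slot_a (tslot K 0 0); tnat _ 0; tnat _ 0] k)))).

(** A false member proposed in block 1 is refuted by the test in block 2; a true one passes every
    test and must be justified. *)
Definition fsystem : qf_formula N :=
  FAnd fgoal (fimp (fapprox (tslot K 0 0) (tslot K 1 0))
    (fimp (fleast (tslot K 0 0) (tslot K 1 0) (slot_a (tslot K 2 0)))
       (fex (iota 0 (size RS)) frule))).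

(** Substitution of c is a conjunction with an equation, so the code of the result is an elementary
    function of c and the code of [phi]. *)
Definition finput (c : nat) (phi : qf_formula N) : qf_formula N :=
  FAnd (FEq (slot_a (tslot K 0 0)) (tnat _ c)) phi.

Definition input_sentence (c : nat) (phi : qf_formula N) : sentence :=
  @Sentence QExists [:: K.+1; K.+1; K.+1; K.+1] (finput c phi).

Variable R : realType.
Implicit Types y : 'rV[int]_K.+1.

Definition zeqn (ws : nat -> 'I_4 -> int) (e : equation) : bool :=
  let: (l, m, r, n) := e in
  [&& 0 <= ws l.1 l.2, 0 <= ws r.1 r.2 & ws l.1 l.2 == m%:Z * ws r.1 r.2 + n%:Z].

Definition zentry y2 y3 (i : nat) (k : 'I_4) : int :=
  slot_w (if i == 0%N then zslot y2 0 else zslot y3 i) k.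

Definition zrule y1 y2 y3 y4 (i : nat) : Prop :=
  let r := nth (0%N, [::]) RS i in
  let prm : slot R := slot_map intr (zslot y1 0) in
  [/\ slot_b (zslot y3 0) TAG = i,
      forall p, (0 < p <= r.1)%N -> [/\ in_approx prm (slot_map intr (zslot y3 p)),
        in_least prm (slot_map intr (zslot y3 p)) (slot_a (zslot y4 0))%:~R &
        slot_a (zslot y3 p) < slot_a (zslot y2 0)] &
      all (zeqn (zentry y2 y3)) r.2].

Lemma holds_finput y1 y2 y3 y4 c : let prm : slot R := slot_map intr (zslot y1 0) in
  qf_holds R (env y1 y2 y3 y4) (finput c fsystem) <->
  slot_a (zslot y1 0) = c /\
  [/\ in_approx prm (slot_map intr (zslot y1 1)),
      in_least prm (slot_map intr (zslot y1 1)) (slot_a (zslot y2 1))%:~R,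
      forall k, slot_w (zslot y1 1) k = mkfact 1 c 0 0 k &
      in_approx prm (slot_map intr (zslot y2 0)) ->
      in_least prm (slot_map intr (zslot y2 0)) (slot_a (zslot y3 0))%:~R ->
      exists2 i, (i < size RS)%N & zrule y1 y2 y3 y4 i].
Proof.
move=> prm.
have Es blk p : (blk < 4)%N -> slot_map (eval_term R (env y1 y2 y3 y4)) (tslot K blk p) =
    slot_map intr (zslot (nth y1 [:: y1; y2; y3; y4] blk) p).
  exact: eval_tslot.
have Ea blk p : (blk < 4)%N -> eval_term R (env y1 y2 y3 y4) (slot_a (tslot K blk p)) =
    (slot_a (zslot (nth y1 [:: y1; y2; y3; y4] blk) p))%:~R.
  by move=> h; have := congr1 (@slot_a R) (Es blk p h).
have Eb blk p k : (blk < 4)%N -> eval_term R (env y1 y2 y3 y4) (slot_b (tslot K blk p) k) =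
    (slot_b (zslot (nth y1 [:: y1; y2; y3; y4] blk) p) k)%:~R.
  by move=> h; have := congr1 (fun s => @slot_b R s k) (Es blk p h).
have Ew blk p k : (blk < 4)%N -> eval_term R (env y1 y2 y3 y4) (slot_w (tslot K blk p) k) =
    (slot_w (zslot (nth y1 [:: y1; y2; y3; y4] blk) p) k)%:~R.
  by move=> h; have := congr1 (fun s => @slot_w R s k) (Es blk p h).
have Ee i k : eval_term R (env y1 y2 y3 y4) (entry_term i k) = (zentry y2 y3 i k)%:~R.
  by rewrite /entry_term /zentry; case: eqP => _; rewrite Ew.
have Heq (z : int) (m : nat) : (z%:~R = m%:R :> R) <-> z = m.
  by split=> [/eqP|->] //; rewrite pmulrn eqr_int => /eqP.
have Hfeqn e : qf_holds R (env y1 y2 y3 y4) (feqn e) <-> zeqn (zentry y2 y3) e.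
  case: e => [[[l m] r] n] /=; rewrite !holds_fand !holds_fle !Ee /= !ler0z.
  have -> : qf_holds R (env y1 y2 y3 y4)
     (FEq (entry_term l.1 l.2) (TAdd (TScale m%:~R (entry_term r.1 r.2)) (tnat _ n))) <->
     zentry y2 y3 l.1 l.2 = m%:Z * zentry y2 y3 r.1 r.2 + n%:Z.
    rewrite /qf_holds Ee [eval_term _ _ (TAdd _ _)]/= Ee !ratr_int mulr1.
    rewrite -intrM -intrD.
    by split=> [/eqP|->] //; rewrite eqr_int => /eqP.
  split; first by move=> [-> [-> ->]]; rewrite eqxx.
  by move=> /and3P [-> -> /eqP ->].
have Hrule i : qf_holds R (env y1 y2 y3 y4) (frule i) <-> zrule y1 y2 y3 y4 i.
  rewrite /frule /zrule !holds_fand !holds_fall.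
  have -> : qf_holds R (env y1 y2 y3 y4) (FEq (slot_b (tslot K 2 0) TAG) (tnat _ i)) <->
     slot_b (zslot y3 0) TAG = i by rewrite /qf_holds eval_tnat Eb // Heq.
  split=> [[h1 [h2 h3]]|[h1 h2 h3]]; split=> //.
  - move=> p /andP [p0 pr]; have := h2 p; rewrite mem_iota p0 add1n ltnS pr => /(_ isT).
    move=> /holds_fand [/holds_fapprox ha /holds_fand [/holds_fleast hb hc]].
    rewrite !Es // in ha; rewrite !Es // Ea // in hb.
    by split=> //; move: hc; rewrite /qf_holds !Ea // ltr_int.
  - by apply/allP => e /h3 /Hfeqn.
  - split; last by move=> e er; apply/Hfeqn; exact: (allP h3).
    move=> p; rewrite mem_iota add1n ltnS => /h2 [ha hb hc].
    apply/holds_fand; split; first by apply/holds_fapprox; rewrite !Es.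
    apply/holds_fand; split; first by apply/holds_fleast; rewrite !Es // Ea.
    by rewrite /qf_holds !Ea // ltr_int.
have Hin : qf_holds R (env y1 y2 y3 y4) (FEq (slot_a (tslot K 0 0)) (tnat _ c)) <->
   slot_a (zslot y1 0) = c by rewrite /qf_holds eval_tnat Ea // Heq.
have Hk (E : slot_a (zslot y1 0) = c) k : qf_holds R (env y1 y2 y3 y4)
   (FEq (slot_w (tslot K 0 1) k)
      (nth TZero [:: tnat _ 1; slot_a (tslot K 0 0); tnat _ 0; tnat _ 0] k)) <->
   slot_w (zslot y1 1) k = mkfact 1 c 0 0 k.
  rewrite /qf_holds Ew // -Heq /mkfact.
  have -> // : eval_term R (env y1 y2 y3 y4)
      (nth TZero [:: tnat _ 1; slot_a (tslot K 0 0); tnat _ 0; tnat _ 0] k) =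
      (nth 0%N [:: 1%N; c; 0%N; 0%N] k)%:R.
  case: k => [[|[|[|[|]]]]] // k4; try exact: eval_tnat.
  by apply: etrans (Ea 0%N 0%N isT) _; rewrite E.
have Happ blk p : (blk < 4)%N ->
    qf_holds R (env y1 y2 y3 y4) (fapprox (tslot K 0 0) (tslot K blk p)) <->
    in_approx prm (slot_map intr (zslot (nth y1 [:: y1; y2; y3; y4] blk) p)).
  by move=> h; rewrite holds_fapprox !Es.
have Hleast blk p blk' p' : (blk < 4)%N -> (blk' < 4)%N ->
    qf_holds R (env y1 y2 y3 y4)
      (fleast (tslot K 0 0) (tslot K blk p) (slot_a (tslot K blk' p'))) <->
    in_least prm (slot_map intr (zslot (nth y1 [:: y1; y2; y3; y4] blk) p))
      (slot_a (zslot (nth y1 [:: y1; y2; y3; y4] blk') p'))%:~R.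
  by move=> h h'; rewrite holds_fleast !Es // Ea.
split.
  move=> /holds_fand [/Hin c1 /holds_fand [/holds_fand [/(Happ 0%N) h1]]].
  move=> /holds_fand [/(Hleast 0%N 1%N 1%N) h2 /holds_fall_ord h3] /holds_fimp h4.
  split=> //; split; [exact: h1 | exact: h2 | by move=> k; apply/Hk |].
  move=> /(Happ 1%N 0%N isT) /h4 /holds_fimp h5.
  move=> /(Hleast 1%N 0%N 2%N 0%N isT isT) /h5 /holds_fex [i].
  by rewrite mem_iota => /andP [_ iS] /Hrule; exists i.
move=> [c1 [h1 h2 h3 h4]]; apply/holds_fand; split; first by apply/Hin.
apply/holds_fand; split.
  apply/holds_fand; split; first exact/(Happ 0%N).
  apply/holds_fand; split; first exact/(Hleast 0%N 1%N 1%N).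
  by apply/holds_fall_ord => k; apply/Hk.
apply/holds_fimp => /(Happ 1%N 0%N isT) g1.
apply/holds_fimp => /(Hleast 1%N 0%N 2%N 0%N isT isT) g2.
have [i iS /Hrule ir] := h4 g1 g2.
by apply/holds_fex; exists i => //; rewrite mem_iota.
Qed.
End Sentences.

(** * Truth of the sentence is provability *)

Section Correctness.
Local Open Scope ring_scope.
Variables (R : realType) (K : nat) (RS : seq rule).
Hypothesis K62 : (62 <= K)%N.
Hypothesis RS_small : all small_rule RS.

Let coordK p : (p <= 6)%N -> (9 * p + 8 <= K)%N.
Proof. by move=> p6; apply: leq_trans K62; lia. Qed.

Lemma zeqn_absz (ws : nat -> 'I_4 -> int) e :
  zeqn ws e -> eqn_holds (fun p k => `|ws p k|%N) e.
Proof.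
case: e => [[[l m] r] n] /= /and3P [l0 r0 /eqP E]; rewrite -eqz_nat.
by rewrite PoszD PoszM !gez0_abs // E.
Qed.

(** Induction on the position of a member: its premises are members at strictly smaller
    positions. *)
Lemma sentence_sound c :
  holds R (input_sentence c (fsystem K RS)) -> provable RS (mkfact 1 c 0 0).
Proof.
move=> /holds_EAEA [y1 H].
pose prm : slot R := slot_map intr (zslot y1 0).
pose member (s : slot int) := in_approx prm (slot_map intr s) /\
  forall j : int, in_least prm (slot_map intr s) j%:~R.
have main m s : member s -> (`|slot_a s| < m)%N -> provable RS (fun k => `|slot_w s k|%N).
  elim: m s => [//|m IH] s ms sm.
  have [y3 H3] := H (block_of K (fun=> s)).
  have E4 y4 := proj1 (holds_finput RS R y1 (block_of K (fun=> s)) y3 y4 c) (H3 y4).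
  have Es : zslot (block_of K (fun=> s)) 0 = s by apply: zslot_block_of; exact: coordK.
  have rules y4 : exists2 i, (i < size RS)%N & zrule RS R y1 (block_of K (fun=> s)) y3 y4 i.
    have [_ [_ _ _ h]] := E4 y4; rewrite Es in h.
    by apply: h; [exact: ms.1 | exact: ms.2].
  have [i iRS [ri _ eqs]] := rules 0.
  pose r := nth (0%N, [::]) RS i.
  have r6 : (r.1 <= 6)%N.
    by have /andP [] := allP RS_small r (mem_nth _ iRS).
  have -> : (fun k => `|slot_w s k|%N) =
      (fun p k => `|zentry (block_of K (fun=> s)) y3 p k|%N) 0%N.
    by apply: funext => k; rewrite /zentry eqxx Es.
  apply: (@Derive RS r (fun p k => `|zentry (block_of K (fun=> s)) y3 p k|%N)).
  - exact: mem_nth.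
  - move=> p pr.
    (* Block 3 runs over all tests j; [ri] shows that the rule stays the one found for block 3 equal
       to 0. *)
    have prem (j : int) : [/\ in_approx prm (slot_map intr (zslot y3 p)),
        in_least prm (slot_map intr (zslot y3 p)) j%:~R & slot_a (zslot y3 p) < slot_a s].
      have [i' _ []] := rules (block_of K (fun=> Slot j (fun=> 0) (fun=> 0))).
      rewrite ri => -[<-] /(_ p pr).
      by rewrite Es zslot_block_of //; exact: coordK.
    have [in_p _ lt_ps] := prem 0.
    have -> : (fun k => `|zentry (block_of K (fun=> s)) y3 p k|%N) =
        (fun k => `|slot_w (zslot y3 p) k|%N).
      by apply: funext => k; rewrite /zentry; case: p pr {prem in_p lt_ps}.
    apply: IH; first by split=> // j; have [] := prem j.
    have [p0 _ _] := in_approx_ge0 in_p; have [s0 _ _] := in_approx_ge0 ms.1.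
    by rewrite ltnS in sm; apply: leq_trans sm; rewrite -ltz_nat !gez0_abs.
  - by apply/allP => e /(allP eqs); exact: zeqn_absz.
have start : member (zslot y1 1) /\ forall k, slot_w (zslot y1 1) k = mkfact 1 c 0 0 k.
  have S (j : int) : [/\ in_approx prm (slot_map intr (zslot y1 1)),
      in_least prm (slot_map intr (zslot y1 1)) j%:~R &
      forall k, slot_w (zslot y1 1) k = mkfact 1 c 0 0 k].
    have [y3 H3] := H (block_of K (fun=> Slot j (fun=> 0) (fun=> 0))).
    have [_ [h1 h2 h3 _]] := proj1 (holds_finput RS R _ _ _ _ _) (H3 0).
    by split=> //; move: h2; rewrite zslot_block_of //; exact: coordK.
  have [h1 _ h3] := S 0; split=> //; split=> // j; by have [] := S j.
have := main _ _ start.1 (leqnn _).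
by congr provable; apply: funext => k; rewrite start.2 absz_nat.
Qed.

(** Block 0 codes a derivation. Block 2 either refutes the proposed member or gives its rule and the
    earlier entries justifying it. *)
Lemma sentence_complete c :
  provable RS (mkfact 1 c 0 0) -> holds R (input_sentence c (fsystem K RS)).
Proof.
move=> /provable_derivation [L DL [i0 i0L Li0]].
have [C [Y [A [B [V [al [al_size al_sorted LB [H1 H2 _]]]]]]]] := list_coded R L.
have al_lt i j : (i < j)%N -> (j <= size L)%N ->
    (nth 0 (rcons al A) i < nth 0 (rcons al A) j)%N.
  move=> ij jL; apply: (sorted_ltn_nth ltn_trans 0%N al_sorted) => //;
  by rewrite inE size_rcons ltnS al_size // ltnW // (leq_trans ij).
have alE i : (i < size L)%N -> nth 0%N (rcons al A) i = nth 0%N al i.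
  by move=> iL; rewrite nth_rcons al_size iL.
have al_ltA i : (i < size L)%N -> (nth 0 al i < A)%N.
  move=> iL; have := al_lt i (size L) iL (leqnn _).
  by rewrite alE // nth_rcons al_size ltnn eqxx.
have /choice [bb bbP] : forall i, exists b, (i < size L)%N ->
    coded (sin C%:R) (fun k => sin (V k)%:R) (cos Y%:R : R)
      (nth 0%N al i) b (nth (fun=> 0%N) L i).
  move=> i; case: (ltnP i (size L)) => [/H1 [b ?]|_]; last by exists (fun=> 0%N).
  by exists b.
pose prmN := Slot c (fun k : 'I_4 => nth 0%N [:: C; Y; A; B] k) V.
pose memb i := Slot (nth 0%N al i) (bb i) (nth (fun=> 0%N) L i).
pose posz : slot nat -> slot int := slot_map Posz.
pose y1 := block_of K (fun p => posz (if p == 0%N then prmN else memb i0)).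
have y10 : zslot y1 0 = posz prmN by rewrite zslot_block_of //; exact: coordK.
have y11 : zslot y1 1 = posz (memb i0) by rewrite zslot_block_of //; exact: coordK.
have memb_in i : (i < size L)%N ->
    in_approx (natr_slot R prmN) (slot_map intr (posz (memb i))) /\
    forall j : int, in_least (natr_slot R prmN) (slot_map intr (posz (memb i))) j%:~R.
  move=> iL; apply/in_coded; split; [exact: al_ltA | by move=> k; exact: LB | exact: bbP].
apply/holds_EAEA; exists y1 => y2.
pose s := zslot y2 0.
suff [y3 Hy3] : exists y3, forall y4,
    in_approx (natr_slot R prmN) (slot_map intr s) ->
    in_least (natr_slot R prmN) (slot_map intr s) (slot_a (zslot y3 0))%:~R ->
    exists2 i, (i < size RS)%N & zrule RS R y1 y2 y3 y4 i.
  exists y3 => y4; apply/holds_finput; rewrite y10 y11; split=> //.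
  have [m1 m2] := memb_in i0 i0L.
  split; [exact: m1 | exact: m2 | by move=> k; rewrite -Li0 | exact: Hy3].
have [sP|sP] := pselect (in_approx (natr_slot R prmN) (slot_map intr s)); last first.
  by exists 0 => y4 /sP.
have [sQ|] := pselect
  (forall j : int, in_least (natr_slot R prmN) (slot_map intr s) j%:~R); last first.
  move=> /existsNP [j sQ]; exists (block_of K (fun=> Slot j (fun=> 0) (fun=> 0))) => y4 _.
  by rewrite zslot_block_of // coordK.
have [sa sb sw] := in_approx_ge0 sP.
rewrite slot_map_absz // in sP sQ.
have [aA wB scod] := proj1 (in_coded _ _ _) (conj sP sQ).
have [i iL [sai swi]] := H2 _ _ _ aA wB scod.
have [r [ws [rRS ws0 prem eqs]]] := DL i iL.
have /choice [jj jjP] : forall p, exists j, (0 < p <= r.1)%N ->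
    (j < i)%N /\ ws p = nth (fun=> 0%N) L j.
  move=> p; have [/prem [j ji wp]|_] := boolP (0 < p <= r.1)%N; last by exists 0%N.
  by exists j.
have /andP [r6 /allP eq6] := allP RS_small r rRS.
(* Slot 0 holds the rule index. Beyond the premises, the raw facts [ws p] are stored, since the
   equations may mention them. *)
pose y3 := block_of K (fun p => if p == 0%N then Slot 0 (fun=> (index r RS : int)) (fun=> 0)
  else posz (if (p <= r.1)%N then memb (jj p) else Slot 0%N (fun=> 0%N) (ws p))).
have y3E p : (p <= 6)%N -> zslot y3 p =
    (if p == 0%N then Slot 0 (fun=> (index r RS : int)) (fun=> 0)
  else posz (if (p <= r.1)%N then memb (jj p) else Slot 0%N (fun=> 0%N) (ws p))).
  by move=> p6; rewrite zslot_block_of // coordK.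
exists y3 => y4 _ _; exists (index r RS); first by rewrite index_mem.
have entryE p k : (p <= 6)%N -> zentry y2 y3 p k = ws p k.
  move=> p6; rewrite /zentry; case: eqP => [->|/eqP p0].
    by rewrite -/s ws0 -swi; exact: esym (gez0_abs (sw k)).
  rewrite y3E // (negbTE p0); case: leqP => // pr.
  have [|_ ->] // := jjP p; by rewrite lt0n p0.
split.
- by rewrite y3E.
- rewrite nth_index // => p pr; have /andP [p0 pr1] := pr.
  have [ji _] := jjP p pr; have jL := ltn_trans ji iL.
  rewrite y10 y3E; last exact: leq_trans pr1 r6.
  rewrite eqn0Ngt p0 pr1; have [m1 m2] := memb_in _ jL.
  split; [exact: m1 | exact: m2 |].
  have -> : slot_a (zslot y2 0) = nth 0%N al i by rewrite -sai; exact: esym (gez0_abs sa).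
  rewrite [slot_a _]/= ltz_nat.
  by have := al_lt (jj p) i ji (ltnW iL); rewrite !alE.
- rewrite nth_index //; apply/allP => -[[[l m] r'] n] er.
  have /andP [/= l6 r'6] := eq6 _ er; have := allP eqs _ er => /= /eqP E.
  by rewrite !entryE // E PoszD PoszM eqxx.
Qed.

Lemma holds_input_sentence c :
  holds R (input_sentence c (fsystem K RS)) <-> provable RS (mkfact 1 c 0 0).
Proof. by split; [exact: sentence_sound | exact: sentence_complete]. Qed.
End Correctness.

(** * Diagonalization *)

Definition computable n (F : n.-tuple nat -> nat) : Prop :=
  exists f : prec_fun n, forall v, computes f v (F v).

Lemma computable_proj n (i : 'I_n) : computable (fun v => tnth v i).
Proof. by exists (PProj i). Qed.

Lemma computable_comp m n (F : m.-tuple nat -> nat) (G : 'I_m -> n.-tuple nat -> nat) :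
  computable F -> (forall i, computable (G i)) ->
  computable (fun v => F (mktuple (G^~ v))).
Proof.
move=> [f fF] /choice [g gG]; exists (PComp f g) => v.
by exists (mktuple (G^~ v)); split=> [i|]; [rewrite tnth_mktuple | exact: fF].
Qed.

Lemma computable_succ n (F : n.-tuple nat -> nat) :
  computable F -> computable (fun v => (F v).+1).
Proof.
move=> HF.
have -> : (fun v => (F v).+1) = (fun v => (thead [tuple F v | i < 1]).+1).
  by apply: funext => v; rewrite /thead tnth_mktuple.
by apply: (@computable_comp 1 n (fun v => (thead v).+1) (fun=> F)) => //; exists PSucc.
Qed.

Lemma computable_const n c : @computable n (fun=> c).
Proof.
elim: c => [|c IH]; last exact: computable_succ.
(* Composing [PZero] with the empty family gives 0 at arity n. *)
exists (PComp PZero (fun i : 'I_0 => False_rect _ (elimF idP (ltn0 i) (ltn_ord i)))) => v.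
by exists [tuple]; split=> // -[].
Qed.

Lemma computable_op n op (F G : n.-tuple nat -> nat) :
  computable (fun v : 2.-tuple nat => op (tnth v ord0) (tnth v ord_max)) ->
  computable F -> computable G -> computable (fun v => op (F v) (G v)).
Proof.
move=> Hop HF HG; have := @computable_comp 2 n _ (fun i => if i == ord0 then F else G) Hop.
have -> : (fun v : n.-tuple nat => op (F v) (G v)) = (fun v =>
    op (tnth [tuple (if i == ord0 then F else G) v | i < 2] ord0)
       (tnth [tuple (if i == ord0 then F else G) v | i < 2] ord_max)).
  by apply: funext => v; rewrite !tnth_mktuple.
by apply=> i; case: eqP.
Qed.

Lemma computable_rec n (F : n.-tuple nat -> nat) (G : n.+2.-tuple nat -> nat)
    (H : n.+1.-tuple nat -> nat) :
  computable F -> computable G ->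
  (forall x : n.-tuple nat, H [tuple of 0 :: x] = F x) ->
  (forall i (x : n.-tuple nat), H [tuple of i.+1 :: x] =
    G [tuple of i :: H [tuple of i :: x] :: x]) ->
  computable H.
Proof.
move=> [f fF] [g gG] H0 HS; exists (PRec f g) => v.
exists (fun i => H [tuple of i :: [tuple of behead v]]); split.
- by rewrite H0.
- by move=> i _; rewrite HS; exact: gG.
- by congr H; apply: val_inj; case/tupleP: v => a x; rewrite /= theadE.
Qed.

Lemma computable_add : computable (fun v : 2.-tuple nat => tnth v ord0 + tnth v ord_max).
Proof.
apply: (computable_rec (F := fun x : 1.-tuple nat => tnth x ord0)
  (G := fun x : 3.-tuple nat => (tnth x (inord 1)).+1)).
- exact: computable_proj.
- exact/computable_succ/computable_proj.
- by move=> x; rewrite !(tnth_nth 0).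
- by move=> i x; rewrite !(tnth_nth 0) inordK.
Qed.

Lemma computable_triangular : computable (fun v : 1.-tuple nat => 'C((tnth v ord0).+1, 2)).
Proof.
apply: (computable_rec (F := fun x : 0.-tuple nat => 0)
  (G := fun x : 2.-tuple nat => tnth x ord_max + (tnth x ord0).+1)).
- exact: computable_const.
- apply: computable_op computable_add _ _; first exact: computable_proj.
  exact/computable_succ/computable_proj.
- by move=> x; rewrite (tnth_nth 0).
- by move=> i x; rewrite !(tnth_nth 0) /= binS bin1.
Qed.

Lemma computable_cpair n (F G : n.-tuple nat -> nat) :
  computable F -> computable G -> computable (fun v => cpair (F v) (G v)).
Proof.
move=> HF HG; apply: (computable_op computable_add _ HG).
have -> : (fun v => 'C((F v + G v).+1, 2)) =
    (fun v => 'C((tnth [tuple F v + G v | i < 1] ord0).+1, 2)).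
  by apply: funext => v; rewrite tnth_mktuple.
apply: (computable_comp (G := fun _ v => F v + G v) computable_triangular) => _.
exact: (computable_op computable_add HF HG).
Qed.

(** * Codes of sentences and the diagonal *)

Definition code_input (K c m : nat) : nat :=
  cpair 0 (cpair (code_seq [:: K.+1; K.+1; K.+1; K.+1])
    (cpair 3 (cpair (code_formula (FEq (slot_a (tslot K 0 0)) (tnat _ c))) m))).

Lemma code_input_sentence K c phi :
  code_sentence (@input_sentence K c phi) = code_input K c (code_formula phi).
Proof. by []. Qed.

Lemma computable_code_input K :
  computable (fun v : 1.-tuple nat => code_input K (tnth v ord0) (tnth v ord0)).
Proof.
have C := computable_const 1; have V := computable_proj (ord0 : 'I_1).
apply: (computable_cpair (C _) (computable_cpair (C _) (computable_cpair (C _) _))).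
apply: (computable_cpair _ V).
apply: (computable_cpair (C _) (computable_cpair (C _) (computable_cpair (C _) _))).
apply: (computable_cpair _ (C _)).
(* The numeral is the rational c / 1 applied to the term 1, so c enters its code only as 2 c. *)
under eq_fun do rewrite /code_rat numq_int denq_int /=.
apply: (computable_cpair _ (C _)).
under eq_fun do rewrite -addnn.
exact: (computable_op computable_add V V).
Qed.

Theorem EAEA_undecidable (R : realType) (K : nat) :
  62 <= K -> ~ decidable_class R (EAEA_sentence K.+1).
Proof.
move=> K62 [f fP].
have [d dP] := computable_code_input K.
pose g := PComp f (fun _ : 'I_1 => d).
pose phi := fsystem K (system (ufun_of g)).
pose s := input_sentence (code_formula phi) phi.
have small : all small_rule (system (ufun_of g)) by apply/allP => r; exact: system_small.
have [b []] := fP s (conj erefl erefl); rewrite /s.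
rewrite code_input_sentence holds_input_sentence // -computes_system.
have dE m : computes d [tuple m] (code_input K m m) := dP [tuple m].
move: {dP dE} (dE (code_formula phi)).
move: (code_formula phi) => c; move: (code_input K c c) => x dx fb.
(* The sentence with code x holds iff [g] maps c to 0, thus iff [f] answers 0 on it, whereas
   correctness of [f] says that it holds iff the answer is 1. *)
suff gE : computes g [tuple c] 0 <-> computes f [tuple x] 0.
  rewrite gE; case: b fb => fb [bT bF]; last by have := bF fb.
  by have := computes_det fb (bT isT).
split=> [[w [/(_ ord0) dw fw]]|fx].
  suff -> : [tuple x] = w by [].
  by apply: eq_from_tnth => i; rewrite !ord1 (computes_det dw dx) (tnth_nth 0).
by exists [tuple x]; split=> // i; rewrite ord1 (tnth_nth 0).
Qed.

Theorem theoremA (R : realType) : ~ decidable_class R (EAEA_sentence 3388).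
Proof. exact: (@EAEA_undecidable R 3387 isT). Qed.
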